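(* There exists $\epsilon_0>0$ such that the following holds for every constant $0<\epsilon<\epsilon_0$. Let $d=d(n)$ satisfy $d=o(n)$, $d\ge 3$, and let $p=\frac{1+\epsilon}{d}$. Let $\alpha$ satisfy $2\sqrt{\frac{d}{n}}<\alpha<\epsilon^2$, and let $G=(V,E)$ be an $(n,d,\lambda)$-graph with $\lambda/d\le \alpha^{2/\alpha}$. Let $L_1$ be a largest connected component of $G[V_p]$. Then there exists a constant $\beta=\beta(\epsilon)>0$ such that with probability at least $1-\exp\left(-\beta\frac{\alpha^2 n}{d}\right)$, $$\left||L_1|-\frac{xn}{d}\right|\le \frac{7\alpha n}{d},$$ where $x$ is the unique solution in $(0,1)$ of $x=(1+\epsilon)(1-e^{-x})$.
   Context: An $(n,d,\lambda)$-graph is a $d$-regular graph on $n$ vertices whose adjacency eigenvalues $d=\lambda_1\ge\lambda_2\ge\dots\ge\lambda_n$ satisfy $\lambda=\max(|\lambda_2|,|\lambda_n|)$. $V_p$ is the random subset of $V$ obtained by including each vertex independently with probability $p$, and $G[V_p]$ is the induced subgraph. The parameter $\alpha$ may depend on $n$ (or $d$). *)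

(* Defs.v *)
From HB Require Import structures.
From mathcomp Require Import all_boot all_order all_algebra.
From mathcomp Require Import all_classical all_reals all_analysis.

Set Implicit Arguments.
Unset Strict Implicit.
Unset Printing Implicit Defensive.

Import Order.TTheory GRing.Theory Num.Theory.
Import numFieldNormedType.Exports.

Local Open Scope ring_scope.

Record sgraph := SGraph {
  vertex :> finType;
  adj : rel vertex;
  adj_sym : symmetric adj;
  adj_irrefl : irreflexive adj
}.

Section Subgraph.
Variables (G : sgraph) (S : {set G}).

Definition induced_adj : rel {v : G | v \in S} :=
  fun u v => adj (val u) (val v).

Lemma induced_adj_sym : symmetric induced_adj.
Proof. by move=> u v; rewrite /induced_adj adj_sym. Qed.

Lemma induced_adj_irrefl : irreflexive induced_adj.
Proof. by move=> u; rewrite /induced_adj adj_irrefl. Qed.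

Definition induced_subgraph : sgraph :=
  SGraph induced_adj_sym induced_adj_irrefl.

End Subgraph.

Definition graph_components (G : sgraph) : {set {set G}} :=
  equivalence_partition (connect (@adj G)) [set: G].

(* All largest components have this size, so no choice among ties is needed;
   it is 0 for the graph without vertices. *)
Definition largest_component_size (G : sgraph) : nat :=
  (\max_(C in graph_components G) #|C|)%N.

Definition regular_graph (G : sgraph) (d : nat) : Prop :=
  forall v : G, #|[set w | adj v w]| = d.

Definition adjacency_matrix (R : realType) (G : sgraph) : 'M[R]_#|G| :=
  \matrix_(i, j) (adj (enum_val i) (enum_val j))%:R.

(* [s] lists the eigenvalues of [G], with multiplicity, in nonincreasing order:
   the i-th largest eigenvalue is s`_(i.-1). *)
Definition spectrum_of (R : realType) (G : sgraph) (s : seq R) : Prop :=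
  sorted (fun a b : R => b <= a) s /\
  char_poly (adjacency_matrix R G) = \prod_(a <- s) ('X - a%:P).

Definition ndl_graph (R : realType) (n d : nat) (lambda : R) (G : sgraph)
  : Prop :=
  [/\ #|G| = n, regular_graph G d &
      exists s : seq R,
        [/\ spectrum_of G s, s`_0 = d%:R &
            lambda = Num.max `|s`_1| `|s`_(n.-1)|]].

(* The probability that V_p = S: each vertex is kept, independently, with
   probability p. *)
Definition subset_weight (R : realType) (G : sgraph) (p : R) (S : {set G}) : R :=
  \prod_(v : G) (if v \in S then p else 1 - p).

Definition subset_prob (R : realType) (G : sgraph) (p : R)
    (A : pred {set G}) : R :=
  \sum_(S : {set G} | A S) subset_weight p S.

(* Main.v *)
(* Explore G[V_p] one query at a time: ask whether a vertex lies in V_p, always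
   preferring an unqueried neighbour of a vertex already found.  The answers are
   i.i.d. Bernoulli(p) whatever the graph looks like, and the components are the
   sets found between consecutive moments at which every neighbour of a found
   vertex has been queried.  Write N = n / d.  Two events suffice.
   (1) After k queries the number of found vertices is p k up to (eps/10) alpha N,
   for all k at once.
   (2) Every D in V_p with |D| <= 3 eps N satisfies
   |N(D)| / n = 1 - exp(-|D|/N) up to 2 eps alpha.
   At a moment when y N vertices are found and all their neighbours are queried,
   they give (1+eps)(1 - exp(-y)) - y <= O(eps alpha), so y is within 3 alpha of 0
   or at least x - 3 alpha; and no component exceeds (x + 3 alpha) N + 1.  Hence
   the component that carries y from one range to the other is the giant.
   For (1), alpha^2 N is only known to exceed 4, so a maximal inequality must be
   supplemented by a small ball estimate.  For (2), order D as w_1, ..., w_s: if the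
   degree of each w_i into the vertices not yet seen is typical, D expands well,
   and by the spectral gap at most alpha^(4/alpha) (10/alpha)^2 n vertices are
   atypical for a given set.  A poorly expanding D contains about eps alpha N
   atypical steps, which beats the union bound over all D. *)

Require Import Defs.
From mathcomp Require Import all_boot all_order all_algebra.
From mathcomp Require Import all_classical all_reals all_analysis.
From mathcomp Require Import spectral complex.
From mathcomp Require Import ring lra zify.
(* Imported again so that the finset names take precedence over those of
   classical_sets. *)
From mathcomp Require Import fintype finset.
Set Implicit Arguments.
Unset Strict Implicit.
Unset Printing Implicit Defensive.
Import Order.TTheory GRing.Theory Num.Theory.
Import numFieldNormedType.Exports.
Local Open Scope ring_scope.

(** * Spectral gap and degrees *)

Section SpectralGap.
Local Open Scope sesquilinear_scope.

Lemma char_poly_conj (F : fieldType) n (P A D : 'M[F]_n) :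
  P \in unitmx -> P *m A = D *m P -> char_poly A = char_poly D.
Proof.
move=> uP PA; pose P' := map_mx polyC P.
have detP' : \det P' != 0.
  by rewrite det_map_mx polyC_eq0 -unitfE -unitmxE.
apply: (mulfI detP'); rewrite /char_poly [RHS]mulrC -!det_mulmx.
congr (\det _).
rewrite /char_poly_mx mulmxBr mulmxBl scalar_mxC -!map_mxM.
by rewrite PA.
Qed.

(** Diagonalize [A] unitarily, which preserves inner products. As [a0] is not in [s] it is a simple
    eigenvalue, so [u] lives on a single coordinate [i0]; orthogonality kills [f] there, and every
    other coordinate is scaled by at most [lam]. *)
Lemma normalmx_gap (C : numClosedFieldType) n (A : 'M[C]_n) (a0 lam : C)
    (s : seq C) (u f : 'rV[C]_n) :
  A \is normalmx -> char_poly A = \prod_(a <- a0 :: s) ('X - a%:P) ->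
  a0 \notin s -> (forall b, b \in s -> `|b| <= lam) -> u != 0 ->
  u *m A = a0 *: u -> f *m u ^t* = 0 ->
  \sum_i `|(f *m A) 0 i| ^+ 2 <= lam ^+ 2 * \sum_i `|f 0 i| ^+ 2.
Proof.
move=> /orthomx_spectralP.
set P := spectralmx A; set D := spectral_diag A => AE cA a0s sle u0 uA fu.
have uniP : P \is unitarymx by apply: spectral_unitarymx.
have unitP : P \in unitmx by apply: spectral_unit.
have PV : invmx P = P^t* by rewrite invmx_unitary.
have normE (g : 'rV[C]_n) : \sum_i `|g 0 i| ^+ 2 = (g *m g ^t*) 0 0.
  by rewrite mxE; apply: eq_bigr => i _; rewrite !mxE normCK.
have unitE (g h : 'rV[C]_n) : (g *m P) *m (h *m P)^t* = g *m h^t*.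
  rewrite trmx_mul map_mxM mulmxA -[g *m P *m _]mulmxA.
  by move/unitarymxP: uniP => ->; rewrite mulmx1.
have -> : f = f *m invmx P *m P by rewrite mulmxKV.
have fE : f = f *m invmx P *m P by rewrite mulmxKV.
have uE : u = u *m invmx P *m P by rewrite mulmxKV.
set g := f *m invmx P; set h := u *m invmx P.
have gA : g *m P *m A = g *m diag_mx D *m P.
  by rewrite [in LHS]AE !mulmxA mulmxK.
have hD : h *m diag_mx D = a0 *: h.
  apply: (can_inj (mulmxK unitP)); rewrite -scalemxAl -uE -uA [in RHS]AE.
  by rewrite [in RHS]uE !mulmxA mulmxK.
rewrite gA !normE !unitE -!normE.
have hDi i : h 0 i * (D 0 i - a0) = 0.
  have /rowP/(_ i) := hD; rewrite mul_mx_diag !mxE => E.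
  by rewrite mulrBr E mulrC subrr.
have cD : perm_eq [seq D 0 i | i <- enum 'I_n] (a0 :: s).
  apply: prod_XsubC_eq; rewrite -cA (@char_poly_conj _ _ P A (diag_mx D)) //.
    rewrite char_poly_trig ?diag_mx_is_trig // big_map big_enum /=.
    by apply: eq_bigr => i _; rewrite mxE eqxx mulr1n.
  by rewrite [in LHS]AE !mulmxA mulmxV // mul1mx.
have gh : g *m h ^t* = 0 by rewrite -[LHS]unitE -fE -uE.
have uhP : u = h *m P := uE.
clearbody g h.
have [i0 hi0] : exists i, h 0 i != 0.
  apply/existsP; apply: contraNT u0; rewrite negb_exists => /forallP h0.
  rewrite uhP; suff -> : h = 0 by rewrite mul0mx.
  by apply/rowP => i; have := h0 i; rewrite negbK => /eqP ->; rewrite mxE.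
have Di0 : D 0 i0 = a0.
  by apply/eqP; rewrite -subr_eq0; have /eqP := hDi i0; rewrite mulf_eq0 (negPf hi0).
have cnt : count_mem a0 [seq D 0 i | i <- enum 'I_n] = 1%N.
  by rewrite (permP cD) /= eqxx; move/count_memPn: a0s ->.
have uniq_i0 i : i != i0 -> D 0 i != a0.
  move=> ii0; apply/eqP => Di; move: cnt; rewrite count_map.
  rewrite -size_filter => /eqP; rewrite eqn_leq => /andP[+ _].
  rewrite leqNgt => /negP; apply.
  apply: (@leq_trans (size [:: i; i0])) => //.
  apply: uniq_leq_size; first by rewrite /= inE ii0.
  move=> j; rewrite !inE mem_filter /= mem_enum => /orP[] /eqP ->.
    by rewrite Di eqxx.
  by rewrite Di0 eqxx.
have gi0 : g 0 i0 = 0.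
  have /matrixP/(_ 0 0) := gh; rewrite !mxE (bigD1 i0) //= big1.
    rewrite addr0 !mxE => /eqP; rewrite mulf_eq0 conjC_eq0 (negPf hi0) orbF.
    by move/eqP.
  move=> i ii0; rewrite !mxE.
  have := hDi i; move/eqP; rewrite mulf_eq0 subr_eq0 (negPf (uniq_i0 _ ii0)) orbF.
  by move/eqP ->; rewrite conjC0 mulr0.
rewrite mulr_sumr; apply: ler_sum => i _.
rewrite mul_mx_diag !mxE; have [->|ii0] := eqVneq i i0.
  by rewrite gi0 mul0r normr0 expr0n mulr0.
rewrite normrM exprMn mulrC ler_wpM2r ?exprn_ge0 //.
have : D 0 i \in a0 :: s.
  by rewrite -(perm_mem cD); apply: map_f; rewrite mem_enum.
rewrite inE (negPf (uniq_i0 _ ii0)) /= => /sle Dle.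
by rewrite lerXn2r // nnegrE // (le_trans _ Dle).
Qed.

(** Over [R[i]] a real symmetric matrix is normal, and the squared moduli of real entries are their
    squares, so [normalmx_gap] applies. *)
Lemma symmetric_gap (R : rcfType) n (A : 'M[R]_n) (a0 lam : R)
    (s : seq R) (u f : 'rV[R]_n) :
  A^T = A -> char_poly A = \prod_(a <- a0 :: s) ('X - a%:P) ->
  a0 \notin s -> (forall b, b \in s -> `|b| <= lam) -> u != 0 ->
  u *m A = a0 *: u -> \sum_i f 0 i * u 0 i = 0 ->
  \sum_i (f *m A) 0 i ^+ 2 <= lam ^+ 2 * \sum_i f 0 i ^+ 2.
Proof.
move=> symA cA a0s sle u0 uA fu.
pose rc : {rmorphism R -> R[i]} := real_complex R.
have rcn x : `|rc x| = rc `|x|.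
  by rewrite normc_def /= expr0n addr0 sqrtr_sqr.
have rcr x : Num.conj (rc x) = rc x.
  by apply/CrealP/complex_realP; exists x.
have rcin : injective rc by exact: fmorph_inj.
have realA : map_mx rc A \is a realmx.
  by apply/mxOverP => i j; rewrite mxE; apply/complex_realP; eexists.
have hA : map_mx rc A \is normalmx.
  apply: symmetric_normalmx => //.
  by apply/is_hermitianmxP; rewrite expr0 scale1r map_mx_id // map_trmx symA.
have := @normalmx_gap _ _ (map_mx rc A) (rc a0) (rc lam) (map rc s)
  (map_mx rc u) (map_mx rc f) hA.
rewrite -map_char_poly cA rmorph_prod /= -map_cons big_map.
have <- : \prod_(a <- a0 :: s) map_poly rc ('X - a%:P) =
   \prod_(j <- a0 :: s) ('X - (rc j)%:P).
  by apply: eq_bigr => a _; rewrite rmorphB /= map_polyX map_polyC.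
move=> /(_ erefl); rewrite mem_map // => /(_ a0s) H.
rewrite -lecR rmorphM rmorphXn !rmorph_sum.
have sqE (g : 'rV[R]_n) : \sum_i `|map_mx rc g 0 i| ^+ 2 =
    \sum_i rc (g 0 i ^+ 2).
  by apply: eq_bigr => i _; rewrite mxE rcn -rmorphXn real_normK ?num_real.
move: H; rewrite -(map_mxM rc f A) !sqE => H; apply: H.
- by move=> _ /mapP[b bs ->]; rewrite rcn lecR sle.
- by rewrite map_mx_eq0.
- by rewrite -map_mxM uA map_mxZ.
- apply/matrixP => i j; rewrite !ord1 !mxE -[RHS](rmorph0 rc) -fu rmorph_sum.
  by apply: eq_bigr => k _; rewrite !mxE rcr rmorphM.
Qed.

End SpectralGap.

(** The indicator of [U] minus its mean is orthogonal to the constant eigenvector. Its image under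
    the adjacency matrix is the deviation of the degrees into [U], and its squared norm is
    [#|U| - #|U|^2 / n]. *)
Lemma degree_variance (R : realType) n d (lambda : R) (G : sgraph) (U : {set G}) :
  ndl_graph n d lambda G -> (1 < n)%N -> lambda < d%:R ->
  \sum_(w : G) (#|[set v in U | adj w v]|%:R - d%:R * #|U|%:R / n%:R) ^+ 2
    <= lambda ^+ 2 * #|U|%:R.
Proof.
move=> [Gn reg [s [[sorted_s cs] s0 lamE]]] n1 ltd.
have n0 : n%:R != 0 :> R by rewrite pnatr_eq0; lia.
have size_s : size s = n.
  have := congr1 (fun q : {poly R} => size q) cs.
  by rewrite size_char_poly size_prod_XsubC Gn => -[].
case: s sorted_s cs s0 lamE size_s => [|a0 s]; first by move=> _ _ _ _ /= E; move: n1; rewrite -E.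
move=> sorted_s cs /= a0E lamE [size_s].
(* The list is sorted, so its tail lies between the second and the last entry, whose moduli [lambda]
   bounds. *)
have sle b : b \in s -> `|b| <= lambda.
  move=> bs; have tr : transitive (fun a b : R => b <= a).
    by move=> x y z yx zy; apply: le_trans yx.
  have sorted_s' : sorted (fun a b : R => b <= a) s by apply: path_sorted sorted_s.
  have ib : (index b s < size s)%N by rewrite index_mem.
  have b1 : b <= s`_0.
    rewrite -(nth_index 0 bs).
    by apply: (sorted_leq_nth tr _ 0 sorted_s') => //; rewrite inE; lia.
  have b2 : s`_(size s).-1 <= b.
    rewrite -(nth_index 0 bs).
    have ib2 : ((size s).-1 < size s)%N by lia.
    by apply: (sorted_leq_nth tr _ 0 sorted_s') => //; rewrite -ltnS prednK //; case: (size s) ib.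
  have s_last : (a0 :: s)`_n.-1 = s`_(size s).-1.
    by rewrite -size_s; case: (s) bs.
  rewrite lamE s_last ler_norml le_max.
  have [h|h] := leP 0 b; last first.
    apply/andP; split; last by rewrite (le_trans (ltW h)) // le_max normr_ge0.
    rewrite lerNl le_max; apply/orP; right.
    by rewrite ler0_norm ?lerN2 // (le_trans b2) // ltW.
  apply/andP; split; last by rewrite ger0_norm ?b1 // (le_trans h).
  by rewrite lerNl (le_trans (_ : _ <= 0)) ?oppr_le0 // le_max normr_ge0.
have a0s : a0 \notin s.
  by apply/negP => /sle; rewrite a0E ger0_norm ?ler0n // leNgt ltd.
pose A := adjacency_matrix R G.
pose f : 'rV[R]_#|G| := \row_i ((enum_val i \in U)%:R - #|U|%:R / n%:R).
pose u : 'rV[R]_#|G| := const_mx 1.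
have symA : A^T = A by apply/matrixP => i j; rewrite !mxE adj_sym.
have sum_nb (w : G) (B : {set G}) :
    \sum_(i < #|G|) (enum_val i \in B)%:R * (adj (enum_val i) w)%:R =
    #|[set v in B | adj w v]|%:R :> R.
  rewrite -(big_enum_val (A := G)
     (fun v => (v \in B)%:R * (adj v w)%:R : R)) /=.
  rewrite -sum1_card natr_sum [RHS]big_mkcond /=.
  apply: eq_bigr => v _; rewrite inE (adj_sym w v).
  by case: (v \in B); case: (adj v w) => /=; rewrite ?mulr1 ?mulr0 ?mul0r.
have sum_adj (w : G) : \sum_(i < #|G|) (adj (enum_val i) w)%:R = d%:R :> R.
  have := sum_nb w [set: G]%SET; rewrite -(reg w) => E.
  rewrite (_ : [set v | adj w v] = [set v in [set: G]%SET | adj w v]).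
    by rewrite -E; apply: eq_bigr => i _; rewrite inE mul1r.
  by apply/setP => v; rewrite !inE.
have sumU : \sum_(i < #|G|) (enum_val i \in U)%:R = #|U|%:R :> R.
  rewrite -(big_enum_val (A := G) (fun v => (v \in U)%:R : R)) /=.
  rewrite -sum1_card natr_sum [RHS]big_mkcond /=.
  by apply: eq_bigr => v _; case: (v \in U).
have u0 : u != 0.
  have G0 : (0 < #|G|)%N by rewrite Gn; lia.
  apply/eqP => /rowP/(_ (Ordinal G0)); rewrite !mxE => /eqP.
  by rewrite oner_eq0.
have uA : u *m A = a0 *: u.
  apply/rowP => j; rewrite !mxE a0E mulr1 -(sum_adj (enum_val j)).
  by apply: eq_bigr => i _; rewrite !mxE mul1r.
have fu : \sum_i f 0 i * u 0 i = 0.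
  under eq_bigr do rewrite !mxE mulr1.
  rewrite sumrB sumU sumr_const card_ord Gn -[_ *+ n]mulr_natr mulfVK //.
  by rewrite subrr.
have := symmetric_gap symA cs a0s sle u0 uA fu.
have -> : \sum_i (f *m A) 0 i ^+ 2 =
  \sum_(w : G) (#|[set v in U | adj w v]|%:R - d%:R * #|U|%:R / n%:R) ^+ 2.
  rewrite (big_enum_val (A := G)
    (fun w : G => (#|[set v in U | adj w v]|%:R - d%:R * #|U|%:R / n%:R) ^+ 2 : R)) /=.
  apply: eq_bigr => j _; congr (_ ^+ 2); rewrite !mxE.
  under eq_bigr do rewrite !mxE mulrBl.
  rewrite sumrB sum_nb -mulr_sumr sum_adj; congr (_ - _).
  by rewrite mulrC mulrA.
move/le_trans; apply; apply: ler_wpM2l; first exact: sqr_ge0.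
under eq_bigr do rewrite !mxE sqrrB.
rewrite big_split sumrB /=.
have -> : \sum_(i < #|G|) (enum_val i \in U)%:R ^+ 2 = #|U|%:R :> R.
  by rewrite -sumU; apply: eq_bigr => i _; case: (_ \in _); rewrite ?expr1n ?expr0n.
rewrite sumrMnl -mulr_suml sumU sumr_const card_ord Gn -[(_ / _) ^+ 2 *+ n]mulr_natr.
have -> : #|U|%:R - #|U|%:R * (#|U|%:R / n%:R) *+ 2 + (#|U|%:R / n%:R) ^+ 2 * n%:R
  = #|U|%:R - (#|U|%:R) ^+ 2 / n%:R :> R by field.
by rewrite lerBlDr lerDl divr_ge0 ?ler0n ?sqr_ge0.
Qed.

(** * Bernoulli paths *)

Section BernoulliPath.
Variable R : realType.
Implicit Types (p h y t : R) (b : seq bool) (n : nat).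

Fixpoint bern_expect p n (F : seq bool -> R) : R :=
  if n is m.+1 then p * bern_expect p m (fun b => F (true :: b))
                    + (1 - p) * bern_expect p m (fun b => F (false :: b))
  else F [::].

(** The bits drive a walk with centred increments [c - p]. Carrying the starting point [y] yields
    the one-step recursion behind both bounds on the confinement probability. *)
Fixpoint confined p h y b : bool :=
  (`|y| <= h) && (if b is c :: b' then confined p h (y + c%:R - p) b' else true).

Lemma confined_prefix p h y b k : confined p h y b -> (k <= size b)%N ->
  `|y + (count id (take k b))%:R - p * k%:R| <= h.
Proof.
elim: b y k => [|c b IH] y [|k] //=; rewrite ?andbT.
- by move=> ? _; rewrite mulr0 addr0 subr0.
- by move=> /andP[? _] _; rewrite mulr0 addr0 subr0.
- move=> /andP[_ cf] kb; have := IH _ _ cf kb.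
  rewrite natrD -natr1 mulrDr mulr1; congr (`|_| <= _); ring.
Qed.

Lemma eq_bern_expect p n F F' : F =1 F' -> bern_expect p n F = bern_expect p n F'.
Proof.
elim: n F F' => [|n IH] F F' FF' /=; first exact: FF'.
by congr (_ * _ + _ * _); apply: IH => b.
Qed.

Lemma bern_expect0 p n : bern_expect p n (fun=> 0) = 0.
Proof. by elim: n => [|n IH] //=; rewrite IH; ring. Qed.

Definition confine_prob p h n y := bern_expect p n (fun b => (confined p h y b)%:R).

Lemma confine_probS p h n y : `|y| <= h ->
  confine_prob p h n.+1 y =
  p * confine_prob p h n (y + 1 - p) + (1 - p) * confine_prob p h n (y - p).
Proof.
move=> yh; rewrite /confine_prob /= yh /=.
by congr (_ * _ + _ * _); apply: eq_bern_expect => b; rewrite addr0.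
Qed.

Lemma confine_prob_out p h n y : h < `|y| -> confine_prob p h n y = 0.
Proof.
move=> hy; rewrite -[RHS](bern_expect0 p n); apply: eq_bern_expect => b.
by case: b => [|? ?] /=; rewrite leNgt hy.
Qed.

Lemma expR_quadratic t : `|t| <= 1 / 2 -> expR t <= 1 + t + 2 * t ^+ 2.
Proof.
rewrite ler_norml => /andP[t1 t2].
have e1 : 1 - t <= expR (- t) by have := expR_ge1Dx (- t).
have -> : expR t = (expR (- t))^-1 by rewrite expRN invrK.
have t0 : 0 < 1 - t by lra.
apply: (@le_trans _ _ (1 - t)^-1); first by rewrite lef_pV2 // posrE ?expR_gt0.
by rewrite -[X in X <= _]div1r ler_pdivrMr //; nra.
Qed.

Lemma bernoulli_mgf p t : 0 <= p -> `|t| <= 1 / 2 ->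
  p * expR (t * (1 - p)) + (1 - p) * expR (- (t * p)) <= expR (2 * p * t ^+ 2).
Proof.
move=> p0 /expR_quadratic t_le.
have -> : p * expR (t * (1 - p)) + (1 - p) * expR (- (t * p)) =
  expR (- (t * p)) * (1 + p * (expR t - 1)).
  by rewrite mulrBr mulr1 expRB expRN; field; rewrite expR_eq0.
have -> : expR (2 * p * t ^+ 2) = expR (- (t * p)) * expR (p * (t + 2 * t ^+ 2)).
  by rewrite -expRD; congr expR; ring.
rewrite ler_wpM2l ?expR_ge0 //; apply: le_trans (expR_ge1Dx _).
by rewrite lerD2l ler_wpM2l //; lra.
Qed.

(** A two-sided exponential martingale bound. Outside [[-h, h]] one of the two exponentials is at
    least 1; inside, one step multiplies each of them on average by at most
    [expR (2 * p * t ^+ 2)]. *)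
Lemma confine_prob_tail p h n y t : 0 <= p <= 1 -> 0 <= t <= 1 / 2 ->
  1 - confine_prob p h n y <=
  (expR (t * (y - h)) + expR (t * (- y - h))) * expR (2 * p * t ^+ 2) ^+ n.
Proof.
move=> p01 t01; set K := expR (2 * _ * _).
have K1 : 1 <= K by rewrite -expR0 ler_expR; nra.
have out y' : h < `|y'| -> 1 <= expR (t * (y' - h)) + expR (t * (- y' - h)).
  move=> hy; have /orP[hy1|hy1] : (h < y') || (h < - y').
    by move: hy; rewrite ltNge ler_norml negb_and -!ltNge ltrNr orbC.
  + apply: (@le_trans _ _ (expR (t * (y' - h)))); last by rewrite lerDl expR_ge0.
    by rewrite -expR0 ler_expR mulr_ge0 //; lra.
  + apply: (@le_trans _ _ (expR (t * (- y' - h)))); last by rewrite lerDr expR_ge0.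
    by rewrite -expR0 ler_expR mulr_ge0 //; lra.
elim: n y => [|n IH] y; have [hy|yh] := ltP h `|y|.
- by rewrite confine_prob_out // expr0 subr0 mulr1 out.
- by rewrite /confine_prob /= yh subrr expr0 mulr1 addr_ge0 ?expR_ge0.
- rewrite confine_prob_out // subr0 -[leLHS]mulr1.
  by apply: ler_pM; rewrite ?ler01 ?exprn_ege1 ?out.
- rewrite confine_probS //.
  have t1 : `|t| <= 1 / 2 by rewrite ger0_norm; lra.
  have := bernoulli_mgf (proj1 (andP p01)) t1.
  have tN1 : `|- t| <= 1 / 2 by rewrite normrN.
  have := bernoulli_mgf (proj1 (andP p01)) tN1.
  rewrite sqrrN -/K !mulNr opprK => mN mP.
  have := IH (y + 1 - p); have := IH (y - p).
  have -> : t * (y + 1 - p - h) = t * (y - h) + t * (1 - p) by ring.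
  have -> : t * (y - p - h) = t * (y - h) + - (t * p) by ring.
  have -> : t * (- (y + 1 - p) - h) = t * (- y - h) + - (t * (1 - p)) by ring.
  have -> : t * (- (y - p) - h) = t * (- y - h) + t * p by ring.
  rewrite !expRD exprS.
  move: (expR (t * (y - h))) (expR_ge0 (t * (y - h))) => a a0.
  move: (expR (t * (- y - h))) (expR_ge0 (t * (- y - h))) => b b0.
  move: mP mN (exprn_ege1 n K1).
  move: (expR (t * (1 - p))) (expR (- (t * p))) => c1 c2.
  move: (expR (- (t * (1 - p)))) (expR (t * p)) => d1 d2.
  move: (K ^+ n) => L mP mN L1 H0 H1.
  have -> : 1 - (p * confine_prob p h n (y + 1 - p) + (1 - p) * confine_prob p h n (y - p))
    = p * (1 - confine_prob p h n (y + 1 - p)) + (1 - p) * (1 - confine_prob p h n (y - p)).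
    ring.
  have p0 : 0 <= p by lra.
  have q0 : 0 <= 1 - p by lra.
  apply: (le_trans (lerD (ler_wpM2l p0 H1) (ler_wpM2l q0 H0))).
  have -> : p * ((a * c1 + b * d1) * L) + (1 - p) * ((a * c2 + b * d2) * L) =
    (a * (p * c1 + (1 - p) * c2) + b * (p * d1 + (1 - p) * d2)) * L by ring.
  rewrite [leRHS]mulrA ler_wpM2r ?(le_trans ler01) // [leRHS]mulrDl.
  by apply: lerD; rewrite ler_wpM2l.
Qed.

(* A discrete substitute for the principal eigenfunction of the walk killed on
   leaving [[-h, h]]; [bump_step] bounds the eigenvalue from below. *)
Let bump h y : R := Num.max 0 (h ^+ 2 - y ^+ 2) ^+ 2.

(** The tangent at [a] of a convex function of [b] lies below its graph. *)
Lemma max0_sqr_tangent (a b : R) : 0 <= a ->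
  a ^+ 2 + 2 * a * (b - a) <= Num.max 0 b ^+ 2.
Proof.
move=> a0; have [b0|b0] := leP 0 b.
  rewrite -subr_ge0 (_ : _ - _ = (b - a) ^+ 2) ?sqr_ge0 //; ring.
by rewrite expr0n /=; nra.
Qed.

(** With [A = h^2 - y^2]: if [A >= h^2 / 2], the tangent bound loses only [2 A p (1 - p)], which is
    at most [4 p A^2 / h^2]. Nearer the boundary the average does not drop below [A^2] at all. The
    range [p <= 7 / 20] covers [(1 + eps) / d] for [d >= 3]. *)
Lemma bump_step p h y : 0 <= p <= 7 / 20 -> 40 <= h -> `|y| <= h ->
  (1 - 4 * p / h ^+ 2) * bump h y <=
  p * bump h (y + 1 - p) + (1 - p) * bump h (y - p).
Proof.
move=> /andP[p0 p1] h40; rewrite ler_norml => /andP[y1 y2].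
have A0 : 0 <= h ^+ 2 - y ^+ 2 by nra.
have hh : 0 < h ^+ 2 by nra.
rewrite /bump (max_r A0).
set A := h ^+ 2 - y ^+ 2; rewrite -/A in A0.
set B1 := h ^+ 2 - (y + 1 - p) ^+ 2; set B2 := h ^+ 2 - (y - p) ^+ 2.
have mx0 (z : R) : 0 <= Num.max 0 z ^+ 2 by rewrite sqr_ge0.
have [Ah|Ah] := leP (h ^+ 2 / 2) A.
  have T1 := max0_sqr_tangent B1 A0.
  have T2 := max0_sqr_tangent B2 A0.
  apply: (@le_trans _ _ (p * (A ^+ 2 + 2 * A * (B1 - A)) + (1 - p) * (A ^+ 2 + 2 * A * (B2 - A)))).
    have -> : p * (A ^+ 2 + 2 * A * (B1 - A)) + (1 - p) * (A ^+ 2 + 2 * A * (B2 - A))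
       = A ^+ 2 - 2 * A * p * (1 - p) by rewrite /B1 /B2 /A; ring.
    rewrite mulrBl mul1r lerD2l lerN2.
    have -> : 4 * p / h ^+ 2 * A ^+ 2 = 2 * A * p * (2 * A / h ^+ 2).
      by field; rewrite gt_eqF //; nra.
    apply: ler_wpM2l; first by rewrite !mulr_ge0.
    by rewrite ler_pdivlMr //; nra.
  by apply: lerD; apply: ler_wpM2l => //; lra.
apply: (@le_trans _ _ (A ^+ 2)).
  rewrite ler_piMl ?sqr_ge0 // lerBlDr lerDl divr_ge0 ?sqr_ge0 //; lra.
have y28 : 25 <= `|y|.
  rewrite -(@ler_pXn2r _ 2) ?nnegrE // real_normK ?num_real //.
  by rewrite /A in Ah; nra.
(* The signs of [B1] and [B2] tell which of the two steps stay in [[-h, h]]; the case where both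
   leave is contradictory. *)
have [B10|B10] := leP 0 B1; have [B20|B20] := leP 0 B2.
- rewrite -subr_ge0.
  have -> : p * B1 ^+ 2 + (1 - p) * B2 ^+ 2 - A ^+ 2 =
    p * (1 - p) * (4 * y ^+ 2 + 4 * y * (1 - 2 * p) + (1 - p) ^+ 3 + p ^+ 3 - 2 * A).
    by rewrite /B1 /B2 /A; ring.
  apply: mulr_ge0; first by apply: mulr_ge0; lra.
  have py : - `|y| <= y * (1 - 2 * p).
    rewrite lerNl -mulrN (le_trans (ler_norm _)) // normrM ler_piMr //.
    by rewrite ler_norml; lra.
  have c3 : 0 <= (1 - p) ^+ 3 by rewrite exprn_ge0; lra.
  have c4 : 0 <= p ^+ 3 by rewrite exprn_ge0; lra.
  have yE : y ^+ 2 = `|y| ^+ 2 by rewrite real_normK ?num_real.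
  have : 2 * A <= 2 * y ^+ 2 by rewrite /A in Ah *; lra.
  rewrite yE; move: (`|y|) y28 py => Y *; nra.
- have yN : y < 0.
    by rewrite ltNge; apply/negP => yp; move: B20; rewrite /B2; nra.
  move: y28; rewrite ltr0_norm // => y28.
  rewrite expr0n /= mulr0 addr0.
  set Y := - y in y28; have yY : y = - Y by rewrite /Y opprK.
  have hY : h < Y + p.
    by rewrite /B2 yY in B20; rewrite ltNge; apply/negP => ?; move: B20; nra.
  have AY : A <= p * (2 * Y + p).
    have -> : A = (h - Y) * (h + Y) by rewrite /A yY; ring.
    apply: ler_pM; lra.
  have B1Y : (1 - p) * (2 * Y - (1 - p)) <= B1.
    have -> : B1 = A + (1 - p) * (2 * Y - (1 - p)) by rewrite /B1 /A yY; ring.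
    by rewrite lerDr.
  (* The constant 3/5 is chosen so that [p <= 7 / 20 < (3 / 5)^2], which turns [p^2] into at most
     [p * (3 / 5)^2]. *)
  have k1 : 3 / 5 * (2 * Y + p) <= (1 - p) * (2 * Y - (1 - p)) by nra.
  have k2 : A ^+ 2 <= p ^+ 2 * (2 * Y + p) ^+ 2.
    by rewrite -exprMn lerXn2r ?nnegrE // mulr_ge0 //; lra.
  have k3 : (3 / 5 * (2 * Y + p)) ^+ 2 <= B1 ^+ 2.
    by rewrite lerXn2r ?nnegrE ?(le_trans k1) // mulr_ge0 //; lra.
  apply: (le_trans k2); apply: le_trans (ler_wpM2l p0 k3).
  rewrite exprMn expr2 -mulrA ler_wpM2l // ler_wpM2r ?sqr_ge0 //; lra.
- have yP : 0 < y.
    by rewrite ltNge; apply/negP => yp; move: B10; rewrite /B1; nra.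
  move: y28; rewrite gtr0_norm // => y28.
  rewrite expr0n /= mulr0 add0r.
  have hY : h < y + (1 - p).
    by rewrite ltNge; apply/negP => ?; move: B10; rewrite /B1; nra.
  have AY : A <= 2 * y + 1.
    have -> : A = (h - y) * (h + y) by rewrite /A; ring.
    rewrite -[leRHS]mul1r; apply: ler_pM; lra.
  have -> : B2 = A + p * (2 * y - p) by rewrite /B2 /A; ring.
  have : A <= (1 - p) * 2 * (2 * y - p) by nra.
  have : 0 <= p * (2 * y - p) by rewrite mulr_ge0 //; lra.
  clear -A0 p0 p1 B2 => {B2}.
  move: (2 * y - p) => z pz Az.
  have s0 : 0 <= (1 - p) * (p * z) ^+ 2 by rewrite mulr_ge0 ?sqr_ge0 //; lra.
  have s1 : A * A <= A * ((1 - p) * 2 * z) by rewrite ler_wpM2l.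
  have s2 : p * (A * A) <= p * (A * ((1 - p) * 2 * z)) by rewrite ler_wpM2l.
  rewrite -subr_ge0.
  have -> : (1 - p) * (A + p * z) ^+ 2 - A ^+ 2 =
    (p * (A * ((1 - p) * 2 * z)) - p * (A * A)) + (1 - p) * (p * z) ^+ 2 by ring.
  lra.
- have yP : 0 < y.
    by rewrite ltNge; apply/negP => yp; move: B10; rewrite /B1; nra.
  move: y28; rewrite gtr0_norm // => y28.
  suff : 0 <= B2 by rewrite leNgt B20.
  rewrite /B2 subr_sqr mulr_ge0 //; lra.
Qed.

(** The bump vanishes outside [[-h, h]] and never exceeds [h ^+ 4], so iterating [bump_step] bounds
    the confinement probability from below. *)
Lemma confine_prob_bump p h n y : 0 <= p <= 7 / 20 -> 40 <= h ->
  (1 - 4 * p / h ^+ 2) ^+ n * bump h y <= h ^+ 4 * confine_prob p h n y.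
Proof.
move=> p01 h40.
have p1 : 0 <= p <= 1 by lra.
have hh : 0 < h ^+ 2 by rewrite exprn_gt0; lra.
have r0 : 0 <= 1 - 4 * p / h ^+ 2.
  by rewrite subr_ge0 ler_pdivrMr // mul1r; nra.
have out m y' : h < `|y'| ->
    (1 - 4 * p / h ^+ 2) ^+ m * bump h y' <= h ^+ 4 * confine_prob p h m y'.
  move=> hy; rewrite confine_prob_out // mulr0 /bump max_l ?expr0n ?mulr0 //.
  by move: hy; rewrite -(@ltr_pXn2r _ 2) ?nnegrE ?real_normK ?num_real //; lra.
elim: n y => [|n IH] y; have [hy|yh] := ltP h `|y|; try exact: out.
- rewrite /confine_prob /= yh expr0 mul1r mulr1 /bump (exprM h 2 2).
  rewrite lerXn2r ?nnegrE ?le_max ?lexx ?sqr_ge0 // ge_max sqr_ge0 /=.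
  by rewrite lerBlDr lerDl sqr_ge0.
- rewrite exprSr -mulrA.
  apply: (le_trans (ler_wpM2l (exprn_ge0 _ r0) (bump_step p01 h40 yh))).
  rewrite confine_probS // mulrDr [leRHS]mulrDr.
  apply: lerD; rewrite mulrCA [leRHS]mulrCA ler_wpM2l //; lra.
Qed.

Lemma confine_prob_ge p h n : 0 <= p <= 7 / 20 -> 40 <= h ->
  expR (- (8 * p * n%:R / h ^+ 2)) <= confine_prob p h n 0.
Proof.
move=> p01 h40.
have hh : 0 < h ^+ 2 by rewrite exprn_gt0; lra.
have := confine_prob_bump n 0 p01 h40.
rewrite /bump expr0n subr0 (max_r (ltW hh)) -(exprM h 2 2) [leLHS]mulrC.
rewrite ler_pM2l ?exprn_gt0 //; last by lra.
apply: le_trans.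
have t0 : 0 <= 4 * p / h ^+ 2 by rewrite divr_ge0 ?sqr_ge0 //; lra.
have t1 : 4 * p / h ^+ 2 <= 1 / 2.
  by rewrite ler_pdivrMr //; nra.
have -> : - (8 * p * n%:R / h ^+ 2) = (- (2 * (4 * p / h ^+ 2))) * n%:R.
  by field; rewrite gt_eqF //; lra.
rewrite expRM_natr lerXn2r ?nnegrE ?expR_ge0 //; first by lra.
move: (4 * p / h ^+ 2) t0 t1 => t t0 t1.
rewrite expRN -[leLHS]div1r ler_pdivrMr ?expR_gt0 //.
have := expR_ge1Dx (2 * t) => e.
apply: (@le_trans _ _ ((1 - t) * (1 + 2 * t))); last by rewrite ler_wpM2l //; lra.
have : 0 <= t * (1 - 2 * t) by rewrite mulr_ge0 //; lra.
by move=> ?; rewrite -subr_ge0 (_ : _ - 1 = t * (1 - 2 * t)) //; ring.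
Qed.

End BernoulliPath.

(** * Exploration *)

Section Exploration.
Variable G : sgraph.
Implicit Types (S P Q D : {set G}) (v w : G).

Definition nbhd D : {set G} := [set v | [exists w in D, adj w v]].

Definition next_query P Q : option G :=
  if [pick v in nbhd P :\: Q] is Some v then Some v else [pick v in ~: Q].

Definition explore_step S Q : {set G} :=
  if next_query (S :&: Q) Q is Some v then v |: Q else Q.

Definition explore S Q k : {set G} := iter k (explore_step S) Q.

Fixpoint answers m S Q : seq bool :=
  if m is m'.+1 then
    if next_query (S :&: Q) Q is Some v then (v \in S) :: answers m' S (v |: Q)
    else [::]
  else [::].

Lemma mem_nbhd D v w : v \in D -> adj v w -> w \in nbhd D.
Proof. by move=> vD vw; rewrite inE; apply/existsP; exists v; rewrite vD. Qed.

Lemma nbhdP D w : reflect (exists2 v, v \in D & adj v w) (w \in nbhd D).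
Proof. by rewrite inE; apply: exists_inP. Qed.

Lemma next_query_some P Q : (0 < #|~: Q|)%N ->
  exists2 v, next_query P Q = Some v & v \notin Q.
Proof.
move=> Q0; rewrite /next_query; case: pickP => [v|_].
  by rewrite inE => /andP[vQ _]; exists v.
case: pickP => [v|Q0']; first by rewrite inE => vQ; exists v.
by move: Q0; rewrite card_gt0 => /set0Pn[v]; rewrite Q0'.
Qed.

Lemma next_query_nbhd P Q : ~~ (nbhd P \subset Q) ->
  exists v, [/\ next_query P Q = Some v, v \notin Q & v \in nbhd P].
Proof.
case/subsetPn => w wP wQ; rewrite /next_query; case: pickP => [v|/(_ w)].
  by rewrite inE => /andP[vQ vP]; exists v.
by rewrite inE wP wQ.
Qed.

Lemma cardsC_setU1 v Q : v \notin Q -> #|~: Q| = #|~: (v |: Q)|.+1.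
Proof.
move=> vQ; rewrite (cardsD1 v) inE vQ; congr (_.+1).
by apply: eq_card => w; rewrite !inE negb_or.
Qed.

Lemma size_answers m S Q : m = #|~: Q| -> size (answers m S Q) = m.
Proof.
elim: m Q => [|m IH] Q // mQ /=.
have [|v -> vQ /=] := @next_query_some (S :&: Q) Q; first by rewrite -mQ.
by rewrite IH //; move: mQ; rewrite (cardsC_setU1 vQ) => -[].
Qed.

(** Deferred decisions: given [S :&: Q = P], the next query depends on [P] and [Q] alone, so its
    answer is a fresh Bernoulli bit. Only the weight of the unqueried vertices enters, which is what
    the induction needs. *)
Lemma answers_law (R : realType) (p : R) m P Q (F : seq bool -> R) :
  P \subset Q -> m = #|~: Q| ->
  \sum_(S : {set G} | S :&: Q == P)
     (\prod_(v in ~: Q) (if v \in S then p else 1 - p)) * F (answers m S Q)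
  = bern_expect p m F.
Proof.
elim: m P Q F => [|m IH] P Q F PQ mQ /=.
  have QT : Q = [set: G].
    by apply: setC_inj; rewrite setCT; apply/eqP; rewrite -cards_eq0 -mQ.
  rewrite (big_pred1 P) => [|S]; last by rewrite QT setIT.
  by rewrite QT setCT big_set0 mul1r.
have [|v nv vQ] := @next_query_some P Q; first by rewrite -mQ.
have vP : v \notin P by apply: contra vQ; apply: (subsetP PQ).
have CQ : #|~: (v |: Q)| = m by move: mQ; rewrite (cardsC_setU1 vQ) => -[].
have prodE S : \prod_(w in ~: Q) (if w \in S then p else 1 - p) =
   (if v \in S then p else 1 - p) *
   \prod_(w in ~: (v |: Q)) (if w \in S then p else 1 - p).
  rewrite (big_setD1 v) ?inE //=; congr (_ * _); apply: eq_bigl => w.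
  by rewrite !inE negb_or.
(* A positive answer continues from [(v |: P, v |: Q)], a negative one from [(P, v |: Q)]. *)
rewrite (bigID (fun S => v \in S)) /=; congr (_ + _).
- rewrite -(IH (v |: P) (v |: Q)) //; last by apply: setUS.
  rewrite mulr_sumr; apply: eq_big => S.
    apply/idP/idP => [/andP[/eqP SQ vS]|/eqP SQ].
      by rewrite setIUr SQ; apply/eqP; congr (_ :|: _);
         apply/setIidPr; rewrite sub1set.
    have vS : v \in S.
      have : v \in v |: P by rewrite !inE eqxx.
      by rewrite -SQ inE => /andP[].
    rewrite vS andbT; apply/eqP/setP => w; have /setP/(_ w) := SQ; rewrite !inE.
    by case: (eqVneq w v) => [->|_] //=; rewrite (negPf vQ) (negPf vP) andbF.
  move=> /andP[/eqP SQ vS]; rewrite prodE vS SQ nv vS; ring.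
- rewrite -(IH P (v |: Q)) //; last by rewrite (subset_trans PQ) ?subsetUr.
  rewrite mulr_sumr; apply: eq_big => S.
    apply/idP/idP => [/andP[/eqP SQ vS]|/eqP SQ].
      rewrite setIUr SQ; apply/eqP/setP => w; rewrite !inE.
      by case: (eqVneq w v) => [->|_]; rewrite ?(negPf vS) ?andbF.
    have vS : v \notin S.
      apply: contra vP => vS; rewrite -SQ !inE vS eqxx //.
    rewrite vS andbT; apply/eqP/setP => w; have /setP/(_ w) := SQ; rewrite !inE.
    by case: (eqVneq w v) => [->|_] //=; rewrite (negPf vQ) (negPf vP) andbF.
  move=> /andP[/eqP SQ vS]; rewrite prodE (negPf vS) SQ nv (negPf vS); ring.
Qed.

Lemma explore_answers k S Q : (k <= #|~: Q|)%N ->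
  #|explore S Q k| = (#|Q| + k)%N /\
  #|S :&: explore S Q k| =
    (#|S :&: Q| + count id (take k (answers #|~: Q| S Q)))%N.
Proof.
elim: k Q => [|k IH] Q kQ; first by rewrite take0 /= !addn0.
rewrite /explore iterSr -/(explore _ _ _) /explore_step.
have [|v nv vQ] := @next_query_some (S :&: Q) Q; first by lia.
rewrite nv (cardsC_setU1 vQ) /= nv /=.
have [|E1 E2] := IH (v |: Q); first by rewrite (cardsC_setU1 vQ) in kQ.
rewrite E1 E2 cardsU1 vQ setIUr; split; first by rewrite /=; lia.
rewrite addnA; congr (_ + _)%N; case: (boolP (v \in S)) => vS.
  have /setIidPr -> : [set v] \subset S by rewrite sub1set.
  by rewrite cardsU1 inE (negPf vQ) andbF; lia.
have -> : S :&: [set v] = set0.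
  by apply/setP => w; rewrite !inE; case: eqVneq => [->|]; rewrite ?andbF ?(negPf vS).
by rewrite set0U addn0.
Qed.

End Exploration.

(** * Components as gaps between consecutive idle moments of the exploration *)

Section ExploredComponents.
Variables (G : sgraph) (S : {set G}).
Implicit Types (a b i j k : nat) (v w : G).
Local Notation Q k := (explore S set0 k).

Definition idle k := nbhd (S :&: Q k) \subset Q k.

Definition idle_gap a b :=
  [/\ (a < b <= #|G|)%N, idle a, idle b &
      forall i, (a < i < b)%N -> ~~ idle i].

Lemma card_explore k : (k <= #|G|)%N -> #|Q k| = k.
Proof.
by move=> kn; have [|-> _] := @explore_answers G k S set0; rewrite ?setC0 ?cardsT ?cards0 ?add0n.
Qed.

Lemma exploreT : Q #|G| = [set: G].
Proof. by apply/eqP; rewrite eqEcard subsetT cardsT card_explore /=. Qed.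

Lemma exploreS k : (k < #|G|)%N ->
  exists2 v, v \notin Q k & Q k.+1 = v |: Q k.
Proof.
move=> kn; have [|v nv vQ] := @next_query_some G (S :&: Q k) (Q k).
  by have := cardsC (Q k); rewrite card_explore; lia.
by exists v => //; rewrite /explore iterS /explore_step nv.
Qed.

Lemma exploreS_busy k : ~~ idle k ->
  exists v, [/\ v \notin Q k, v \in nbhd (S :&: Q k) & Q k.+1 = v |: Q k].
Proof.
move=> /next_query_nbhd[v [nv vQ vn]]; exists v; split => //.
by rewrite /explore iterS /explore_step nv.
Qed.

Lemma explore_sub j k : (j <= k)%N -> Q j \subset Q k.
Proof.
move=> /subnK <-; elim: (k - j)%N => // i IH; apply: (subset_trans IH).
rewrite addSn [in X in _ \subset X]/explore iterS -/(explore _ _ _) /explore_step.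
by case: next_query => // v; apply: subsetUr.
Qed.

Lemma idle0 : idle 0.
Proof.
by apply/subsetP => w /nbhdP[v]; rewrite !inE andbF.
Qed.

Lemma idle_last : idle #|G|.
Proof. by rewrite /idle exploreT subsetT. Qed.

Lemma idle_gap_next a : idle a -> (a < #|G|)%N -> exists b, idle_gap a b.
Proof.
move=> ia an.
have ex : exists b, (a < b <= #|G|)%N && idle b.
  by exists #|G|; rewrite an leqnn idle_last.
exists (ex_minn ex); case: ex_minnP => b /andP[ab ib] bmin; split => // i /andP[ai ibb].
apply/negP => ii; have : (b <= i)%N by apply: bmin; rewrite ii andbT; lia.
lia.
Qed.

Lemma card_found_step k : (#|S :&: Q k.+1| <= #|S :&: Q k|.+1)%N.
Proof.
rewrite /explore iterS -/(explore _ _ _) /explore_step.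
case: next_query => [v|]; last exact: leqnSn.
rewrite setIUr; apply: leq_trans (leq_card_setU _ _) _.
by rewrite -add1n leq_add2r (leq_trans (subset_leq_card (subsetIr _ _))) ?cards1.
Qed.

Lemma card_found_gap a k : (a <= k)%N ->
  (#|S :&: Q a| + #|S :&: (Q k :\: Q a)|)%N = #|S :&: Q k|.
Proof.
move=> ak; rewrite -(cardsID (Q a) (S :&: Q k)); congr (_ + _)%N; apply: eq_card => v.
  rewrite !inE; case vQ : (v \in Q a); rewrite ?andbF ?andbT //.
  by rewrite (subsetP (explore_sub ak)) ?andbT.
by rewrite !inE andbCA.
Qed.

(** A discrete intermediate value argument: one query finds at most one vertex. *)
Lemma found_ivt a b m : (a <= b)%N -> (m <= #|S :&: (Q b :\: Q a)|)%N ->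
  exists2 k, (a <= k <= b)%N & #|S :&: (Q k :\: Q a)| = m.
Proof.
elim: b m => [|b IH] m ab mb.
  exists a; first lia; move: mb; have -> : a = 0%N by lia.
  by rewrite setDv setI0 cards0; lia.
have [ab'|ab'] := leqP a b; last first.
  exists a; first lia; move: mb; have -> : b.+1 = a by lia.
  by rewrite setDv setI0 cards0; lia.
have [mb'|mb'] := leqP m #|S :&: (Q b :\: Q a)|.
  by have [k kab kE] := IH _ ab' mb'; exists k => //; lia.
exists b.+1; first lia; have := card_found_gap ab; have := card_found_gap ab'.
by have := card_found_step b; lia.
Qed.

(** The first query of a gap starts from scratch, which gives the summand 1. Every later one is a
    neighbour of a vertex found within the same gap. *)
Lemma gap_queries a b k : idle_gap a b -> (a < k <= b)%N ->
  (k - a <= 1 + #|nbhd (S :&: (Q k :\: Q a))|)%N.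
Proof.
move=> [/andP[ab bn] ia ib busy] /andP[ak kb].
have [|r rQ QS] := @exploreS a; first lia.
suff sub : Q k :\: Q a \subset r |: nbhd (S :&: (Q k :\: Q a)).
  have -> : (k - a)%N = #|Q k :\: Q a|.
    have := cardsID (Q a) (Q k); rewrite (setIidPr (explore_sub (ltnW ak))).
    rewrite !card_explore; lia.
  apply: leq_trans (subset_leq_card sub) _.
  by rewrite cardsU1; case: (_ \notin _).
elim: k ak kb => // k IH ak kb; have [ak'|ak'] := ltnP a k; last first.
  have -> : k = a by lia.
  rewrite QS; apply/subsetP => v; rewrite !inE => /andP[/negPf vQ].
  by rewrite vQ orbF => ->.
have [|v [vQ /nbhdP[u]]] := @exploreS_busy k; first by apply: busy; lia.
rewrite inE => /andP[uS uQ] uv QkS.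
(* Vertices found before the idle moment [a] have all their neighbours in [Q a], so they cannot
   supply the new query. *)
have uQa : u \notin Q a.
  apply: contra vQ => uQa; apply: (subsetP (explore_sub (ltnW ak'))).
  by apply: (subsetP ia); apply: (mem_nbhd _ uv); rewrite inE uS.
have mono : nbhd (S :&: (Q k :\: Q a)) \subset nbhd (S :&: (Q k.+1 :\: Q a)).
  apply/subsetP => w /nbhdP[u' u'k u'w]; apply: (mem_nbhd _ u'w).
  by move: u'k; rewrite QkS !inE => /and3P[-> -> ->]; rewrite orbT.
apply/subsetP => w; rewrite [in X in X -> _]QkS !inE => /andP[wQa /orP[/eqP ->|wQ]].
  apply/orP; right; apply/existsP; exists u; rewrite uv andbT QkS !inE uS uQ uQa.
  by rewrite orbT.
have := subsetP (IH ak' (ltnW kb)) w; rewrite inE wQ wQa => /(_ isT).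
rewrite in_setU1 => /orP[->//|/(subsetP mono)]; rewrite inE => ->.
by rewrite orbT.
Qed.

Let H : sgraph := induced_subgraph S.

(** By induction on the queries, every vertex found in the gap is connected inside [S] to the first
    queried vertex [r]. *)
Lemma gap_component a b : idle_gap a b ->
  (#|S :&: (Q b :\: Q a)| <= largest_component_size H)%N.
Proof.
move=> [/andP[ab bn] ia ib busy].
have [|r rQ QS] := @exploreS a; first lia.
have conn k : (a < k <= b)%N -> forall v (vS : v \in S), v \in Q k :\: Q a ->
    exists rS : r \in S, connect (@adj H) (exist _ r rS) (exist _ v vS).
  elim: k => // k IH /andP[ak kb] v vS; have [ak'|ak'] := ltnP a k; last first.
    have -> : k = a by lia.
    rewrite QS !inE => /andP[/negPf vQ]; rewrite vQ orbF => /eqP vr.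
    subst v; exists vS; exact: connect0.
  have [|w [wQ /nbhdP[u]]] := @exploreS_busy k; first by apply: busy; lia.
  rewrite inE => /andP[uS uQ] uw QkS.
  have uQa : u \notin Q a.
    apply: contra wQ => uQa; apply: (subsetP (explore_sub (ltnW ak'))).
    by apply: (subsetP ia); apply: (mem_nbhd _ uw); rewrite inE uS.
  rewrite QkS !inE => /andP[vQa /orP[/eqP vw|vQ]]; last first.
    by apply: IH; rewrite ?inE ?vQ ?vQa // ak' ltnW.
  subst w; have [||rS cru] := IH _ u uS; rewrite ?inE ?uQ ?uQa //.
    by rewrite ak' ltnW.
  by exists rS; apply: connect_trans cru _; apply: connect1.
have [->|/set0Pn[v]] := eqVneq (S :&: (Q b :\: Q a)) set0; first by rewrite cards0.
rewrite inE => /andP[vS vQ]; have [|rS _] := conn b _ v vS vQ; first lia.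
pose C : {set H} := [set y in [set: H] | connect (@adj H) (exist _ r rS) y].
have CH : C \in graph_components H.
  by apply/imsetP; exists (exist _ r rS); rewrite ?inE.
suff : (#|S :&: (Q b :\: Q a)| <= #|C|)%N.
  move/leq_trans; apply.
  exact: (@leq_bigmax_cond _ (fun C => C \in graph_components H)
           (fun C : {set H} => #|C|) C CH).
rewrite -(card_imset _ val_inj); apply: subset_leq_card.
apply/subsetP => w; rewrite inE => /andP[wS wQ].
apply/imsetP; exists (exist _ w wS) => //; rewrite !inE.
have [|rS' crw] := conn b _ w wS wQ; first lia.
by rewrite (bool_irrelevance rS rS').
Qed.

(** Every component lies in a single gap: the one starting at the last idle moment before the
    exploration meets the component. *)
Lemma component_gap m :
  (forall a b, idle_gap a b -> (#|S :&: (Q b :\: Q a)| <= m)%N) ->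
  (largest_component_size H <= m)%N.
Proof.
move=> gap_le; apply/bigmax_leqP => C /imsetP[x _ CE].
pose C' := [set val y | y in C].
have xC : val x \in C' by apply: imset_f; rewrite CE !inE connect0.
have ex : exists k, Q k :&: C' != set0.
  by exists #|G|; rewrite exploreT setTI; apply/set0Pn; exists (val x).
(* [Q 0] is empty, so the first meeting time is a successor [j.+1] and [Q j] still misses the
   component. *)
case: (ex_minnP ex) => -[|j] jC jmin.
  by move: jC; rewrite set0I eqxx.
have jn : (j < #|G|)%N.
  have : (j.+1 <= #|G|)%N by apply: jmin; rewrite exploreT setTI; apply/set0Pn; exists (val x).
  by [].
have jC0 : Q j :&: C' = set0.
  by apply/eqP; apply/negPn/negP => /jmin; lia.
have exi : exists i, (i <= j)%N && idle i by exists 0%N; rewrite idle0.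
have bnd i : (i <= j)%N && idle i -> (i <= j)%N by case/andP.
case: (ex_maxnP exi bnd) => a /andP[aj ia] amax.
have [|b gap] := idle_gap_next ia; first by lia.
have [/andP[ab bn] _ ib _] := gap.
have jb : (j < b)%N.
  by rewrite ltnNge; apply/negP => bj; have : (b <= a)%N; [apply: amax; rewrite bj | lia].
apply: leq_trans (gap_le _ _ gap); rewrite -(card_imset _ val_inj) -/C'.
apply: subset_leq_card; apply/subsetP => w wC.
have wS : w \in S by case/imsetP: wC => y _ ->; exact: (valP y).
have wQa : w \notin Q a.
  apply/negP => /(subsetP (explore_sub aj)) wj.
  by have := in_set0 w; rewrite -jC0 inE wj wC.
rewrite !inE wS wQa /=.
(* At the idle moment [b] the vertices found so far are closed under adjacency in [H], so [Q b]
   contains every component that it meets. *)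
have cl : fingraph.closed (@adj H) [pred y : H | val y \in Q b].
  apply: intro_closed; first by apply: sym_connect_sym; apply: induced_adj_sym.
  move=> y z yz /=; rewrite !inE => yQ; apply: (subsetP ib).
  by apply: (@mem_nbhd G _ (val y) (val z) _ yz); rewrite inE yQ (valP y).
case/set0Pn: jC => u; rewrite inE => /andP[uQ /imsetP[u' u'C uE]].
case/imsetP: wC => w' w'C ->.
have same : connect (@adj H) u' w'.
  move: u'C w'C; rewrite CE !inE /= => cu cw; apply: connect_trans cw.
  by rewrite sym_connect_sym //; apply: induced_adj_sym.
have := closed_connect cl same; rewrite !inE => <-.
by rewrite -uE; apply: (subsetP (explore_sub jb)).
Qed.

End ExploredComponents.

(** * The drift of the exploration *)

Section SurvivalFunction.
Variable R : realType.
Implicit Types (eps alpha x y z u w : R).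

(** Squaring the bound at [v / 2] improves the quadratic coefficient [c] to [(1 + 2 c) / 4], with
    fixed point 1/2. Four rounds from [c = 0] give 15/32. *)
Lemma expR_ge_quadratic u : 0 <= u -> 1 + u + 15 / 32 * u ^+ 2 <= expR u.
Proof.
have dbl (c c' : R) : 0 <= c -> c' = (1 + 2 * c) / 4 ->
    (forall v : R, 0 <= v -> 1 + v + c * v ^+ 2 <= expR v) ->
    forall v : R, 0 <= v -> 1 + v + c' * v ^+ 2 <= expR v.
  move=> c0 -> Hc v v0; have v20 : 0 <= v / 2 by lra.
  have -> : expR v = expR (v / 2) ^+ 2 by rewrite -expRM_natl; congr expR; field.
  have cv : 0 <= c * (v / 2) ^+ 2 by rewrite mulr_ge0 ?sqr_ge0.
  apply: (@le_trans _ _ ((1 + v / 2 + c * (v / 2) ^+ 2) ^+ 2)); last first.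
    by rewrite lerXn2r ?nnegrE ?expR_ge0 ?Hc //; lra.
  have c2 : 0 <= c * (v / 2) ^+ 2 * (v + c * (v / 2) ^+ 2) by rewrite mulr_ge0 //; lra.
  rewrite -subr_ge0.
  by rewrite (_ : _ - _ = c * (v / 2) ^+ 2 * (v + c * (v / 2) ^+ 2)) //; field.
have b0 (v : R) : 0 <= v -> 1 + v + 0 * v ^+ 2 <= expR v.
  by move=> _; rewrite mul0r addr0 expR_ge1Dx.
have b1 : forall v : R, 0 <= v -> 1 + v + 1 / 4 * v ^+ 2 <= expR v by apply: dbl b0; lra.
have b2 : forall v : R, 0 <= v -> 1 + v + 3 / 8 * v ^+ 2 <= expR v by apply: dbl b1; lra.
have b3 : forall v : R, 0 <= v -> 1 + v + 7 / 16 * v ^+ 2 <= expR v by apply: dbl b2; lra.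
by move: u; apply: dbl b3; lra.
Qed.

Lemma expRN_le_quadratic y : 0 <= y -> expR (- y) <= 1 - y + 17 / 32 * y ^+ 2.
Proof.
move=> y0; have e := expR_ge_quadratic y0.
have y2 := sqr_ge0 y.
have e0 : 0 < 1 + y + 15 / 32 * y ^+ 2 by lra.
apply: (@le_trans _ _ (1 + y + 15 / 32 * y ^+ 2)^-1).
  by rewrite expRN lef_pV2 // posrE ?expR_gt0.
rewrite -[leLHS]div1r ler_pdivrMr //.
have y3 : 0 <= y ^+ 3 by rewrite exprn_ge0.
have y4 : 0 <= y ^+ 4 by rewrite exprn_ge0.
have -> : (1 - y + 17 / 32 * y ^+ 2) * (1 + y + 15 / 32 * y ^+ 2) =
  1 + 2 / 32 * y ^+ 3 + 255 / 1024 * y ^+ 4 by field.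
lra.
Qed.

Lemma expRN_ge_quadratic y : 0 <= y <= 1 / 2 ->
  1 - y + 1 / 4 * y ^+ 2 <= expR (- y).
Proof.
move=> y01; have -> : expR (- y) = expR (- (y / 2)) ^+ 2.
  by rewrite -expRM_natl; congr expR; field.
have -> : 1 - y + 1 / 4 * y ^+ 2 = (1 + - (y / 2)) ^+ 2 by field.
by rewrite lerXn2r ?nnegrE ?expR_ge0 ?expR_ge1Dx //; lra.
Qed.

(** Compares [exp(-y)] with the expansion of [(1 - y / 8)^8]. *)
Lemma expRN_ge_cubic y : 0 <= y <= 1 ->
  1 - y + 7 / 16 * y ^+ 2 - 1 / 8 * y ^+ 3 <= expR (- y).
Proof.
move=> y01; pose u := y / 4.
have e1 : 1 - u + 1 / 4 * u ^+ 2 <= expR (- u) by apply: expRN_ge_quadratic; rewrite /u; lra.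
have u2 := sqr_ge0 u.
have u0 : 0 <= u <= 1 / 4 by rewrite /u; lra.
have e2 : (1 - u + 1 / 4 * u ^+ 2) ^+ 4 <= expR (- y).
  have -> : expR (- y) = expR (- u) ^+ 4.
    by rewrite -expRM_natl; congr expR; rewrite /u; field.
  by rewrite lerXn2r ?nnegrE ?expR_ge0 //; lra.
apply: le_trans e2.
have -> : y = 4 * u by rewrite /u; field.
have -> : (1 - u + 1 / 4 * u ^+ 2) ^+ 4 = (1 - u / 2) ^+ 8 by field.
have u3 : 0 <= u ^+ 3 by rewrite exprn_ge0 //; lra.
have u4 : 0 <= u ^+ 4 by rewrite exprn_ge0 //; lra.
have u6 : 0 <= u ^+ 6 by rewrite exprn_ge0 //; lra.
have u54 : u ^+ 5 <= 1 / 4 * u ^+ 4 by rewrite exprS ler_wpM2r //; lra.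
have u76 : u ^+ 7 <= 1 / 4 * u ^+ 6 by rewrite exprS ler_wpM2r //; lra.
have u8 : 0 <= u ^+ 8 by rewrite exprn_ge0 //; lra.
have -> : (1 - u / 2) ^+ 8 = 1 - 4 * u + 7 * u ^+ 2 - 7 * u ^+ 3 + 35 / 8 * u ^+ 4
   - 7 / 4 * u ^+ 5 + 7 / 16 * u ^+ 6 - 1 / 16 * u ^+ 7 + 1 / 256 * u ^+ 8 by field.
have -> : (4 * u) ^+ 2 = 16 * u ^+ 2 by ring.
have -> : (4 * u) ^+ 3 = 64 * u ^+ 3 by ring.
lra.
Qed.

Lemma expR_le_quadratic w : 0 <= w <= 1 / 3 -> expR w <= 1 + w + w ^+ 2.
Proof.
move=> w01.
have e1 : 1 - w + 1 / 4 * w ^+ 2 <= expR (- w) by apply: expRN_ge_quadratic; lra.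
have w2 := sqr_ge0 w.
have e0 : 0 < 1 - w + 1 / 4 * w ^+ 2 by lra.
have -> : expR w = (expR (- w))^-1 by rewrite expRN invrK.
apply: (@le_trans _ _ (1 - w + 1 / 4 * w ^+ 2)^-1).
  by rewrite lef_pV2 // posrE ?expR_gt0.
rewrite -[leLHS]div1r ler_pdivrMr // -subr_ge0.
have -> : (1 + w + w ^+ 2) * (1 - w + 1 / 4 * w ^+ 2) - 1 =
  w ^+ 2 * (1 - 3 * w) / 4 + w ^+ 4 / 4 by field.
rewrite addr_ge0 ?mulr_ge0 ?exprn_ge0 ?invr_ge0 //; lra.
Qed.

(** In units of [n / d]: querying all neighbours of [y] found vertices should yield
    [(1 + eps) (1 - exp(-y))] found vertices, and [y] of them are accounted for. *)
Definition drift eps y := (1 + eps) * (1 - expR (- y)) - y.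

(** For [eps > 0] such a root is [1 + eps] times the survival probability of the Poisson([1 + eps])
    branching process. *)
Definition survival_root eps y := 0 < y < 1 /\ y = (1 + eps) * (1 - expR (- y)).

(** For roots [y < z], the tangent of [exp(-t)] at [y] forces [y <= eps], while [exp(y) > 1 + y]
    forces [y > eps]. *)
Lemma survival_root_uniq eps y z : 0 < eps ->
  survival_root eps y -> survival_root eps z -> y = z.
Proof.
move=> e0; wlog yz : y z / y < z => [H|] ry rz.
  have [yz|zy|//] := ltgtP y z; first exact: H.
  by apply/esym; apply: H.
case: ry rz => /andP[y0 y1] yE [/andP[z0 z1] zE]; exfalso.
have q0 : 0 < 1 + eps by lra.
have yE' : (1 + eps) * expR (- y) = 1 + eps - y by rewrite [in RHS]yE; ring.
have zE' : (1 + eps) * expR (- z) = 1 + eps - z by rewrite [in RHS]zE; ring.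
have t1 : expR (- y) * (1 - (z - y)) <= expR (- z).
  have -> : - z = - y + - (z - y) by ring.
  by rewrite expRD ler_wpM2l ?expR_ge0 // expR_ge1Dx.
have t2 : expR (- y) * (1 + y) < 1.
  have : expR (- y) * (1 + y) < expR (- y) * expR y.
    by rewrite ltr_pM2l ?expR_gt0 // expR_gt1Dx // gt_eqF.
  by rewrite -expRD addNr expR0.
have t1' : (1 + eps - y) * (1 - (z - y)) <= 1 + eps - z.
  by rewrite -yE' -zE' -mulrA ler_pM2l.
have t2' : (1 + eps - y) * (1 + y) < 1 + eps.
  by rewrite -yE' -mulrA -[ltRHS]mulr1 ltr_pM2l.
have : 0 <= (z - y) * (eps - y) by lra.
rewrite pmulr_rge0 ?subr_gt0 // subr_ge0 => ye.
have : 0 <= y * (eps - y) by rewrite mulr_ge0 ?subr_ge0 // ltW.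
lra.
Qed.

Lemma driftD eps x w : x = (1 + eps) * (1 - expR (- x)) ->
  drift eps (x + w) = (1 + eps - x) * (1 - expR (- w)) - w.
Proof.
move=> xE; have E : (1 + eps) * expR (- x) = 1 + eps - x by rewrite [in RHS]xE; ring.
rewrite /drift opprD expRD -E.
have -> : - x - w = - ((1 + eps) * (1 - expR (- x))) - w by rewrite -xE.
by ring.
Qed.

Lemma survival_root_bounds eps x : 0 < eps <= 1 / 100 -> survival_root eps x ->
  37 / 20 * eps <= x <= 12 / 5 * eps.
Proof.
move=> /andP[e0 e1] [/andP[x0 x1] xE].
have x2 := expRN_le_quadratic (ltW x0).
have x3 : 1 - x + 7 / 16 * x ^+ 2 - 1 / 8 * x ^+ 3 <= expR (- x).
  by apply: expRN_ge_cubic; lra.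
have q0 : 0 <= 1 + eps by lra.
have l1 : x * ((1 + eps) * (1 - 17 / 32 * x)) <= x * 1.
  have := ler_wpM2l q0 x2; lra.
have l2 : x * 1 <= x * ((1 + eps) * (1 - 7 / 16 * x + 1 / 8 * x ^+ 2)).
  have := ler_wpM2l q0 x3; lra.
rewrite ler_pM2l // in l1; rewrite ler_pM2l // in l2.
have x8 : x ^+ 2 <= x by rewrite expr2 ler_piMr // ltW.
(* This crude bound makes [x] small enough for the quadratic terms to be negligible in the final
   estimate. *)
have l3 : x <= 16 / 5 * eps * 2 by nra.
have x9 : x ^+ 2 <= 8 / 100 * x by rewrite expr2 ler_wpM2r //; lra.
by apply/andP; split; nra.
Qed.

Lemma survival_root_exists eps : 0 < eps <= 1 / 100 -> exists x, survival_root eps x.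
Proof.
move=> /andP[e0 e1].
have cf : continuous (drift eps).
  move=> y; apply: cvgB; last exact: cvg_id.
  apply: cvgM; first exact: cvg_cst.
  apply: cvgB; first exact: cvg_cst.
  apply: (@continuous_comp _ _ _ (fun y : R => - y) (@expR R)); last exact: continuous_expR.
  by apply: cvgN; exact: cvg_id.
have f1 : 0 < drift eps eps.
  have := expRN_le_quadratic (ltW e0); rewrite /drift => h.
  have := ler_wpM2l (_ : 0 <= 1 + eps) h; nra.
have f2 : drift eps (1 / 2) < 0.
  have h : 1 - 1 / 2 + 7 / 16 * (1 / 2) ^+ 2 - 1 / 8 * (1 / 2) ^+ 3 <= expR (- (1 / 2)) :> R.
    by apply: expRN_ge_cubic; lra.
  have := ler_wpM2l (_ : 0 <= 1 + eps) h; rewrite /drift; nra.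
have [||x xin fx] := @IVT R (drift eps) eps (1 / 2) 0 _ (continuous_subspaceT cf).
- lra.
- by rewrite ge_min le_max (ltW f1) (ltW f2) orbT.
move: xin; rewrite in_itv /= => /andP[x0 x1]; exists x; split; first lra.
by move/eqP: fx; rewrite subr_eq0 => /eqP.
Qed.

(** Up to [17 / 10 * eps] the drift dominates a concave quadratic vanishing at 0; above that, the
    exponential is expanded around the root [x]. On each range the bound is weakest next to the
    root. *)
Lemma drift_mid eps alpha x y : 0 < eps <= 1 / 100 -> survival_root eps x ->
  0 < alpha < eps ^+ 2 -> 3 * alpha <= y <= x - 3 * alpha ->
  23 / 10 * (eps * alpha) < drift eps y.
Proof.
move=> e01 rx /andP[a0 ae] /andP[ya yx].
have /andP[xl xu] := survival_root_bounds e01 rx.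
have xE := rx.2; case/andP: e01 => e0 e1.
have ea : 0 < eps * alpha by rewrite mulr_gt0.
have ae2 : alpha <= eps / 100 by nra.
have y0 : 0 <= y by lra.
have [ys|ys] := leP y (17 / 10 * eps).
  have h := ler_wpM2l (_ : 0 <= 1 + eps) (expRN_le_quadratic y0).
  apply: (@lt_le_trans _ _ (y * (eps - (1 + eps) * (17 / 32 * y)))); last first.
    by rewrite /drift; have := h _; lra.
  have k1 : 0 <= (y - 3 * alpha) * (17 / 10 * eps - y) by rewrite mulr_ge0 //; lra.
  have k2 : (1 + eps) * (17 / 32 * y) <= (537 / 1000) * y by nra.
  have k3 : y * (eps - 537 / 1000 * y) <= y * (eps - (1 + eps) * (17 / 32 * y)).
    by rewrite ler_wpM2l //; lra.
  apply: lt_le_trans k3; nra.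
pose w := x - y; have yE : y = x + - w by rewrite /w; ring.
rewrite yE (driftD _ xE) opprK.
have w0 : 3 * alpha <= w by rewrite /w; lra.
have w1 : w <= 7 / 10 * eps by rewrite /w; lra.
have h : expR w <= 1 + w + w ^+ 2 by apply: expR_le_quadratic; lra.
have h2 : (1 + eps - x) * expR w <= (1 + eps - x) * (1 + w + w ^+ 2).
  by rewrite ler_wpM2l //; lra.
apply: (@lt_le_trans _ _ (17 / 20 * eps * w - w ^+ 2)).
  have k1 : 0 <= (w - 3 * alpha) * (7 / 10 * eps - w) by rewrite mulr_ge0 //; lra.
  nra.
have k2 : 0 <= (x - 37 / 20 * eps) * w by rewrite mulr_ge0 //; lra.
have k3 : 0 <= (x - eps) * w ^+ 2 by rewrite mulr_ge0 ?sqr_ge0 //; lra.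
lra.
Qed.

(** By [exp(-w) >= 1 - w] the drift at [x + w] is at most [-(x - eps) w], and
    [x - eps >= 17 / 20 * eps]. *)
Lemma drift_high eps alpha x y : 0 < eps <= 1 / 100 -> survival_root eps x ->
  0 < alpha -> x + 3 * alpha <= y -> drift eps y <= - (12 / 5 * (eps * alpha)).
Proof.
move=> e01 rx a0 xy.
have /andP[xl xu] := survival_root_bounds e01 rx.
have xE := rx.2; case/andP: e01 => e0 e1.
have yE : y = x + (y - x) by ring.
rewrite yE (driftD _ xE); set w := y - x.
have h := expR_ge1Dx (- w).
have h2 : (1 + eps - x) * (1 + - w) <= (1 + eps - x) * expR (- w) by rewrite ler_wpM2l //; lra.
have k1 : 0 <= (x - 37 / 20 * eps) * w by rewrite mulr_ge0 // /w; lra.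
have k2 : 0 <= eps * (w - 3 * alpha) by rewrite mulr_ge0 // /w; lra.
have ea : 0 < eps * alpha by rewrite mulr_gt0.
lra.
Qed.

End SurvivalFunction.

(** Error budget for a gap: expansion costs [2 eps alpha], the extra query [eps alpha / 100], the
    counts at both ends [eps alpha / 10] each. The total, with the factor [1 + eps] on the first
    two, stays below [12 / 5 * (eps * alpha)]. *)
Lemma gap_arith (R : realType) (eps alpha z ga gk ka kk nb E nv : R) :
  0 < eps <= 1 / 100 -> 0 < alpha -> nv <= eps * alpha / 100 ->
  nb - (1 - E) <= 2 * eps * alpha -> gk - (1 + eps) * kk <= eps * alpha / 10 ->
  - (eps * alpha / 10) <= ga - (1 + eps) * ka -> ga + z = gk ->
  kk - ka <= nv + nb -> (1 + eps) * (1 - E) - z <= - (12 / 5 * (eps * alpha)) ->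
  False.
Proof.
move=> /andP[e0 e1] a0 nvle nble gkle gale gE kle dz.
have ea : 0 < eps * alpha by rewrite mulr_gt0.
have q0 : 0 <= 1 + eps by lra.
have kle' : kk - ka <= eps * alpha / 100 + (2 * eps * alpha + (1 - E)) by lra.
have := ler_wpM2l q0 kle'.
have e2a : 0 <= (1 / 100 - eps) * (eps * alpha) by rewrite mulr_ge0 ?(ltW ea) //; lra.
lra.
Qed.

(** Error budget at an idle moment: [2 (1 + eps) + 1 / 10] is less than 23/10. *)
Lemma idle_arith (R : realType) (eps alpha y k nb E : R) :
  0 < eps <= 1 / 100 -> 0 < alpha -> - (2 * eps * alpha) <= nb - (1 - E) ->
  - (eps * alpha / 10) <= y - (1 + eps) * k -> nb <= k ->
  23 / 10 * (eps * alpha) < (1 + eps) * (1 - E) - y -> False.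
Proof.
move=> /andP[e0 e1] a0 nble yle nbk dy.
have ea : 0 < eps * alpha by rewrite mulr_gt0.
have q0 : 0 <= 1 + eps by lra.
have nk' : 1 - E - 2 * eps * alpha <= k by lra.
have := ler_wpM2l q0 nk'.
have e2a : 0 <= (1 / 100 - eps) * (eps * alpha) by rewrite mulr_ge0 ?(ltW ea) //; lra.
lra.
Qed.

(** * Deterministic consequence of accurate counts and expansion *)

Section Deterministic.
Variables (R : realType) (G : sgraph) (S : {set G}) (eps alpha x N : R).
Hypotheses (eps01 : 0 < eps <= 1 / 100) (root_x : survival_root eps x)
  (alpha01 : 0 < alpha < eps ^+ 2) (N_gt0 : 0 < N)
  (N_large : N^-1 <= eps * alpha / 100) (G_gt0 : (0 < #|G|)%N)
  (G_large : #|G|%:R^-1 <= eps * alpha / 100).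
Local Notation Q k := (explore S set0 k).
Hypothesis found_le : forall k, (k <= #|G|)%N ->
  `|#|S :&: Q k|%:R - (1 + eps) * N * (k%:R / #|G|%:R)| <= eps / 10 * alpha * N.
Hypothesis expansion : forall D : {set G}, D \subset S -> #|D|%:R <= 3 * eps * N ->
  `|#|nbhd D|%:R / #|G|%:R - (1 - expR (- (#|D|%:R / N)))| <= 2 * eps * alpha.

Let ea : 0 < eps * alpha.
Proof. by case/andP: eps01 => ? _; case/andP: alpha01 => ? _; rewrite mulr_gt0. Qed.

Let alpha_le : alpha <= eps / 100.
Proof.
case/andP: eps01 => ? e1; case/andP: alpha01 => _ /ltW/le_trans; apply.
by rewrite expr2 ler_pM2l //; lra.
Qed.

Let NV_le : N^-1 <= eps / 100.
Proof.
case/andP: eps01 => e0 e1; apply: (le_trans N_large).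
by rewrite ler_pM2r // ler_piMr ?(ltW e0) // (le_trans alpha_le); lra.
Qed.

Let n_gt0 : 0 < #|G|%:R :> R. Proof. by rewrite ltr0n. Qed.

Let found_norm k : (k <= #|G|)%N ->
  `|#|S :&: Q k|%:R / N - (1 + eps) * (k%:R / #|G|%:R)| <= (eps * alpha) / 10.
Proof.
move=> kn; have := found_le kn.
have -> : #|S :&: Q k|%:R / N - (1 + eps) * (k%:R / #|G|%:R) =
  (#|S :&: Q k|%:R - (1 + eps) * N * (k%:R / #|G|%:R)) / N.
  by field; rewrite !gt_eqF.
have Ni : 0 <= N^-1 by rewrite invr_ge0 ltW.
rewrite normrM (ger0_norm Ni) => h.
by rewrite ler_pdivrMr // (le_trans h) // le_eqVlt; apply/orP; left; apply/eqP; field.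
Qed.

(** An oversized gap is stopped as soon as it holds [m] vertices, just above [(x + 3 alpha) N]. That
    set is still small enough for [expansion], yet the queries made in the gap are too many for its
    neighbourhood, since the drift there is too negative. *)
Lemma gap_upper a b : idle_gap S a b ->
  #|S :&: (Q b :\: Q a)|%:R <= (x + 3 * alpha) * N + 1.
Proof.
move=> gap; have [/andP[ab bn] _ _ _] := gap.
have /andP[xl xu] := survival_root_bounds eps01 root_x.
have [e0 e1] := andP eps01; have [a0 ae] := andP alpha01.
have x0 : 0 <= (x + 3 * alpha) * N by rewrite mulr_ge0 ?ltW //; lra.
pose m := (Num.truncn ((x + 3 * alpha) * N)).+1.
have /andP[m1 m2] := truncn_itv x0.
have m3 : m%:R <= (x + 3 * alpha) * N + 1 by rewrite /m -natr1 lerD2r.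
apply: le_trans m3; rewrite ler_nat leqNgt; apply/negP => mM.
have [k /andP[ak kb] kE] := found_ivt (ltnW ab) (ltnW mM).
have ak' : (a < k)%N.
  rewrite ltn_neqAle ak andbT; apply/eqP => akE.
  by move: kE; rewrite -akE setDv setI0 cards0.
set D := S :&: (Q k :\: Q a) in kE.
have DS : D \subset S by apply: subsetIl.
pose z : R := m%:R / N.
have zN : z <= x + 3 * alpha + N^-1.
  rewrite /z ler_pdivrMr // mulrDl mulVf ?gt_eqF // /m -natr1; lra.
have zx : x + 3 * alpha <= z by rewrite /z ler_pdivlMr // ltW.
have kEz : #|D|%:R / N = z by rewrite kE.
clearbody z.
have D3 : #|D|%:R <= 3 * eps * N.
  have -> : #|D|%:R = z * N by rewrite -kEz divfK ?gt_eqF.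
  rewrite ler_pM2r // (le_trans zN) //.
  by move: NV_le alpha_le => H1 H2; lra.
have := expansion DS D3; rewrite kEz ler_norml => /andP[_ exD].
have kn : (k <= #|G|)%N by apply: leq_trans kb bn.
have := found_norm kn; rewrite ler_norml => /andP[_ fk].
have := @found_norm a (leq_trans ak kn); rewrite ler_norml => /andP[fa _].
have := card_found_gap S ak; rewrite -/D => /(congr1 (fun i : nat => i%:R / N : R)).
rewrite natrD mulrDl kEz => gE.
have : (k - a)%:R / #|G|%:R <= (1 + #|nbhd D|)%:R / #|G|%:R :> R.
  rewrite ler_pM2r ?invr_gt0 // ler_nat; by apply: gap_queries gap _; rewrite ak'.
rewrite natrB // mulrBl natrD mulrDl mul1r => kaq.
have dz := drift_high eps01 root_x a0 zx.
exact: (gap_arith eps01 a0 G_large exD fk fa gE kaq dz).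
Qed.

Lemma idle_dichotomy k : idle S k -> (k <= #|G|)%N -> #|S :&: Q k|%:R / N <= 3 * eps ->
  #|S :&: Q k|%:R / N < 3 * alpha \/ x - 3 * alpha < #|S :&: Q k|%:R / N.
Proof.
move=> ik kn; set y := #|_|%:R / N => y3.
have [e0 e1] := andP eps01; have [a0 ae] := andP alpha01.
have [ya|ya] := ltP y (3 * alpha); first by left.
have [yx|yx] := ltP (x - 3 * alpha) y; first by right.
exfalso; have y_mid : 3 * alpha <= y <= x - 3 * alpha by rewrite ya.
have dy := drift_mid eps01 root_x alpha01 y_mid.
have := expansion (subsetIl S (Q k)) _; rewrite -ler_pdivrMr // -/y => /(_ y3).
rewrite ler_norml => /andP[ex _].
have := found_norm kn; rewrite -/y ler_norml => /andP[fk _].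
have nk : #|nbhd (S :&: Q k)|%:R / #|G|%:R <= k%:R / #|G|%:R :> R.
  rewrite ler_pM2r ?invr_gt0 // ler_nat -[leqRHS](card_explore S kn).
  exact: subset_leq_card.
exact: (idle_arith eps01 a0 ex fk nk dy).
Qed.

Lemma largest_component_near :
  `|(largest_component_size (induced_subgraph S))%:R - x * N| <= 7 * alpha * N.
Proof.
have /andP[xl xu] := survival_root_bounds eps01 root_x.
have [e0 e1] := andP eps01; have [a0 ae] := andP alpha01.
have aN1 : 1 <= alpha * N.
  have : N^-1 * N <= eps * alpha / 100 * N by rewrite ler_pM2r.
  rewrite mulVf ?gt_eqF // => h.
  have k : 0 <= (1 - eps / 100) * (alpha * N) by rewrite !mulr_ge0 ?ltW //; lra.
  lra.
have x0 : 0 <= (x + 3 * alpha) * N + 1 by rewrite addr_ge0 // mulr_ge0 ?ltW //; lra.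
rewrite ler_norml; apply/andP; split; last first.
  have /andP[t1 _] := truncn_itv x0.
  have : (largest_component_size (induced_subgraph S) <=
          Num.truncn ((x + 3 * alpha) * N + 1))%N.
    apply: component_gap => a b gap.
    by rewrite truncn_ge_nat // gap_upper.
  rewrite -(ler_nat R); lra.
(* The giant is the gap following the last idle moment with fewer than [3 alpha N] found
   vertices. *)
pose small k := idle S k && (#|S :&: Q k|%:R / N < 3 * alpha).
have ex : exists k, (k <= #|G|)%N && small k.
  by exists 0%N; rewrite /small idle0 /= setI0 cards0 mul0r; lra.
have bnd k : (k <= #|G|)%N && small k -> (k <= #|G|)%N by case/andP.
case: (ex_maxnP ex bnd) => a /andP[an /andP[ia sa]] amax.
(* After all queries about [(1 + eps) N] vertices are found, so the final moment is not small. *)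
have an' : (a < #|G|)%N.
  rewrite ltn_neqAle an andbT; apply/eqP => aG.
  have := found_norm an; rewrite aG divff ?gt_eqF // -aG ler_norml => /andP[fk _].
  have : eps * alpha <= 1 / 100 * alpha by rewrite ler_pM2r.
  nra.
have [b gap] := idle_gap_next ia an'; have [/andP[ab bn] _ ib _] := gap.
have Mle := gap_upper gap.
have gE := card_found_gap S (ltnW ab).
have gE' : #|S :&: Q a|%:R / N + #|S :&: (Q b :\: Q a)|%:R / N = #|S :&: Q b|%:R / N.
  by rewrite -mulrDl -natrD gE.
have MN : #|S :&: (Q b :\: Q a)|%:R / N <= x + 3 * alpha + N^-1.
  rewrite ler_pdivrMr // mulrDl mulVf ?gt_eqF //.
(* The upper bound on the gap itself keeps [b] within the range of [idle_dichotomy]; by maximality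
   of [a] only the large alternative remains. *)
have b3 : #|S :&: Q b|%:R / N <= 3 * eps by move: NV_le alpha_le => H1 H2; rewrite -gE'; lra.
case: (idle_dichotomy ib bn b3) => [sb|yb].
  by have : (b <= a)%N; [apply: amax; rewrite bn /small ib sb | rewrite leqNgt ab].
have : x - 6 * alpha <= #|S :&: (Q b :\: Q a)|%:R / N by lra.
rewrite ler_pdivlMr // => Mge.
have := gap_component gap; rewrite -(ler_nat R) => L.
have : 0 <= alpha * N by lra.
lra.
Qed.

End Deterministic.

(** * Expansion of random sets *)

Section SubsetProbability.
Variables (R : realType) (G : sgraph).
Implicit Types (p : R) (B : pred {set G}) (D S : {set G}).

Lemma subset_weight_ge0 p S : 0 <= p <= 1 -> 0 <= subset_weight p S.
Proof.
by move=> p01; apply: prodr_ge0 => v _; case: ifP => _; lra.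
Qed.

(** Expanding the product of [p + (1 - p)], with the second term deleted on [D], leaves exactly the
    weights of the supersets of [D]. *)
Lemma subset_prob_superset p D :
  subset_prob p (fun S : {set G} => D \subset S) = p ^+ #|D|.
Proof.
have -> : p ^+ #|D| = \prod_(v : G) (p + (if v \in D then 0 else 1 - p)).
  rewrite -prodr_const big_mkcond; apply: eq_bigr => v _.
  by case: ifP => _; ring.
rewrite bigA_distr /subset_prob big_mkcond; apply: eq_bigr => S _.
case: ifP => [DS|/negbT /subsetPn[v vD vS]].
  apply: eq_bigr => v _; case: ifP => // vS; case: ifP => // vD.
  by rewrite (subsetP DS) in vS.
by rewrite (bigD1 v) //= (negPf vS) vD mul0r.
Qed.

Lemma subset_prob_exists p B : 0 <= p <= 1 ->
  subset_prob p (fun S : {set G} => [exists D : {set G}, (D \subset S) && B D])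
    <= \sum_(D | B D) p ^+ #|D|.
Proof.
move=> p01; have w0 S := subset_weight_ge0 S p01.
under [leRHS]eq_bigr do rewrite -subset_prob_superset /subset_prob big_mkcond.
rewrite exchange_big /subset_prob /= big_mkcond; apply: ler_sum => S _.
have nn (D : {set G}) : 0 <= (if D \subset S then subset_weight p S else 0).
  by case: ifP.
case: ifP => [/existsP[D /andP[DS BD]]|_]; last by apply: sumr_ge0.
by rewrite (bigD1 D) //= DS lerDl sumr_ge0.
Qed.

End SubsetProbability.

(** * Counting sets through their orderings *)

Section OrderedSums.
Variables (R : realType) (T : finType).
Implicit Types (F : seq T -> R) (c : {set T} -> R) (s : nat).

Fixpoint seq_sum s F : R :=
  if s is s'.+1 then \sum_(w : T) seq_sum s' (fun t => F (w :: t)) else F [::].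

Lemma seq_sumZ s a F : seq_sum s (fun t => a * F t) = a * seq_sum s F.
Proof.
by elim: s F => [|s IH] F //=; rewrite mulr_sumr; apply: eq_bigr => w _; rewrite IH.
Qed.

Lemma eq_seq_sum s F F' : F =1 F' -> seq_sum s F = seq_sum s F'.
Proof.
elim: s F F' => [|s IH] F F' FF' /=; first exact: FF'.
by apply: eq_bigr => w _; apply: IH => t.
Qed.

(** Each [s]-set is counted once for each of its [s]! orderings; repeated entries only add
    nonnegative terms. The induction removes the first entry. *)
Lemma seq_sum_sets s c F : (forall t, 0 <= F t) ->
  (forall t, uniq t -> size t = s -> c [set w in t] <= F t) ->
  s`!%:R * \sum_(D : {set T} | #|D| == s) c D <= seq_sum s F.
Proof.
elim: s c F => [|s IH] c F F0 cF.
  rewrite fact0 mul1r /= (big_pred1 set0) => [|D]; last by rewrite cards_eq0.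
  have <- : [set w in [::]] = set0 :> {set T} by apply/setP => w; rewrite !inE.
  exact: cF.
pose c' (w : T) (D : {set T}) := if w \in D then 0 else c (w |: D).
have IHw w : s`!%:R * \sum_(D : {set T} | #|D| == s) c' w D <= seq_sum s (fun t => F (w :: t)).
  apply: IH => [t|t ut st]; first exact: F0.
  rewrite /c' inE; case: ifPn => [_|wt]; first exact: F0.
  have <- : [set v in w :: t] = w |: [set v in t] by apply/setP => v; rewrite !inE.
  by apply: cF; rewrite /= ?wt ?st.
apply: le_trans (ler_sum _ (fun w _ => IHw w)) => /=.
rewrite -mulr_sumr factS natrM [_ * s`!%:R]mulrC -mulrA [s.+1%:R * _]mulrC.
apply: ler_wpM2l; first exact: ler0n.
have -> : (\sum_(D : {set T} | #|D| == s.+1) c D) * s.+1%:R =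
   \sum_(D : {set T} | #|D| == s.+1) \sum_(w in D) c D.
  by rewrite mulr_suml; apply: eq_bigr => D /eqP <-; rewrite sumr_const mulr_natr.
rewrite le_eqVlt; apply/orP; left; apply/eqP.
(* Double counting of pairs [w \in D]: a set with [s.+1] elements containing [w] is [w] joined to an
   [s]-set avoiding it. *)
rewrite (exchange_big_dep predT) //=; apply: eq_bigr => w _.
rewrite (reindex_onto (fun D => w |: D) (fun D => D :\ w)) /=; last first.
  by move=> D /andP[_ wD]; rewrite setD1K.
rewrite [RHS](bigID (fun D : {set T} => w \in D)) /= [X in _ = X + _]big1 ?add0r; last first.
  by move=> D /andP[_ wD]; rewrite /c' wD.
apply: eq_big => D.
  case: (boolP (w \in D)) => wD; rewrite ?andbF ?andbT.
    apply/negbTE; rewrite negb_and; apply/orP; right.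
    by apply: contraTneq wD => <-; rewrite !inE eqxx.
  by rewrite setU1K // eqxx cardsU1 wD !inE eqxx !andbT eqSS.
rewrite /c' => /andP[_ /eqP wD]; case: ifP => // wD'.
by move: wD'; rewrite -wD !inE eqxx.
Qed.

End OrderedSums.

(** * Growth of a neighbourhood along an ordering *)

Section NeighbourhoodGrowth.
Variables (R : realType) (G : sgraph) (d : nat) (delta eta : R).
Hypotheses (reg : regular_graph G d) (G_gt0 : (0 < #|G|)%N) (dG : (d <= #|G|)%N).
Implicit Types (U D : {set G}) (w v : G) (ws : seq G).
Let rho : R := d%:R / #|G|%:R.

Definition degree_to w U := #|[set v in U | adj w v]|.

Definition bad_vertices U : {set G} :=
  [set w | delta * d%:R < `|(degree_to w U)%:R - d%:R * #|U|%:R / #|G|%:R|].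

Hypothesis card_bad : forall U, #|bad_vertices U|%:R <= eta * #|G|%:R.

(** [U] is the set of vertices not yet adjacent to an earlier entry, so badness of an entry is
    judged against what it can still add. *)
Fixpoint bad_steps U ws : nat :=
  if ws is w :: ws' then ((w \in bad_vertices U) + bad_steps (U :\: nbhd [set w]) ws')%N
  else 0%N.

(** An exponential moment bound: whatever the history, summing one step over [w] gives at most
    [n + tau * eta * n <= 2 n]. *)
Lemma seq_sum_bad_steps s U tau : 1 <= tau -> tau * eta <= 1 ->
  seq_sum s (fun t => tau ^+ bad_steps U t) <= (2 * #|G|%:R) ^+ s.
Proof.
move=> tau1 taueta; elim: s U => [|s IH] U //=.
have step w : seq_sum s (fun t => tau ^+ ((w \in bad_vertices U) +
      bad_steps (U :\: nbhd [set w]) t)%N) <=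
    (if w \in bad_vertices U then tau else 1) * (2 * #|G|%:R) ^+ s.
  under eq_seq_sum do rewrite exprD.
  rewrite seq_sumZ; case: ifP => _; rewrite ?expr0 ?expr1 ler_wpM2l // ?ler01 //.
  by rewrite (le_trans ler01).
apply: le_trans (ler_sum _ (fun w _ => step w)) _.
rewrite -mulr_suml exprS ler_wpM2r ?exprn_ge0 ?mulr_ge0 ?ler0n //.
apply: (@le_trans _ _ (\sum_(w : G) (1 + (if w \in bad_vertices U then tau else 0)))).
  by apply: ler_sum => w _; case: ifP => _; rewrite ?addr0 // lerDr ler01.
rewrite big_split /= sumr_const -big_mkcond sumr_const -mulr_natr -[tau *+ _]mulr_natr.
rewrite mul1r mulrDl mul1r lerD2l (le_trans (ler_wpM2l _ (card_bad U))) //.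
  by rewrite (le_trans ler01).
by rewrite mulrA -[leRHS]mul1r ler_wpM2r ?ler0n.
Qed.

(** A typical step shrinks the untouched fraction by the factor [1 - rho] up to [delta * rho]; a bad
    step is off by at most [rho], as its degree and the expected one both lie in [[0, d]]. Later
    factors do not amplify errors. *)
Lemma untouched_bad_steps U ws :
  `|#|U :\: nbhd [set w in ws]|%:R / #|G|%:R - (1 - rho) ^+ size ws * (#|U|%:R / #|G|%:R)|
    <= ((size ws)%:R * Num.max 0 delta + (bad_steps U ws)%:R) * rho.
Proof.
have n0 : 0 < #|G|%:R :> R by rewrite ltr0n.
have rho0 : 0 <= rho by rewrite divr_ge0.
have rho1 : rho <= 1 by rewrite ler_pdivrMr // mul1r ler_nat.
elim: ws U => [|w ws IH] U /=.
  have -> : U :\: nbhd [set w in [::]] = U.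
    apply/setP => v; rewrite !inE; case: existsP => //= -[w].
    by rewrite !inE.
  by rewrite expr0 mul1r subrr normr0 mul0r add0r mul0r.
set U' := U :\: nbhd [set w].
have -> : U :\: nbhd [set v in w :: ws] = U' :\: nbhd [set v in ws].
  apply/setP => v; rewrite !inE andbA; congr (_ && _); rewrite -negb_or; congr (~~ _).
  apply/existsP/orP => [[u]|[] /existsP[u /andP[]]].
  - rewrite !inE => /andP[/orP[/eqP ->|uws] uv]; [right|left]; apply/existsP.
      by exists w; rewrite inE eqxx.
    by exists u; rewrite inE uws.
  - by rewrite !inE => uws uv; exists u; rewrite !inE uws orbT.
  - by rewrite !inE => /eqP -> uv; exists w; rewrite !inE eqxx.
have cU' : #|U'|%:R = #|U|%:R - (degree_to w U)%:R :> R.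
  rewrite -(cardsID (nbhd [set w]) U) natrD /degree_to.
  have -> : [set v in U | adj w v] = U :&: nbhd [set w].
    apply/setP => v; rewrite !inE; congr (_ && _); apply/idP/existsP.
      by move=> wv; exists w; rewrite inE eqxx.
    by case=> u; rewrite inE => /andP[/eqP ->].
  by rewrite addrAC subrr add0r.
have degd : (degree_to w U <= d)%N.
  rewrite -(reg w); apply: subset_leq_card; apply/subsetP => v.
  by rewrite !inE => /andP[].
have e1 : `|#|U'|%:R / #|G|%:R - (1 - rho) * (#|U|%:R / #|G|%:R)| <=
   (Num.max 0 delta + (w \in bad_vertices U)%:R) * rho.
  have -> : #|U'|%:R / #|G|%:R - (1 - rho) * (#|U|%:R / #|G|%:R) =
     - (((degree_to w U)%:R - d%:R * #|U|%:R / #|G|%:R) / #|G|%:R).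
    by rewrite cU' /rho; field; rewrite gt_eqF.
  rewrite normrN normrM (@ger0_norm _ (_^-1)) ?invr_ge0 ?ler0n //.
  rewrite /rho mulrA ler_pM2r ?invr_gt0 //.
  rewrite inE; case: ltP => [_|h]; rewrite /= ?addr0; last first.
    by apply: le_trans h _; rewrite ler_wpM2r // le_max lexx orbT.
  apply: (@le_trans _ _ d%:R); last first.
    by rewrite mulrDl mul1r lerDr mulr_ge0 // le_max lexx.
  have Un : #|U|%:R / #|G|%:R <= 1 :> R.
    by rewrite ler_pdivrMr // mul1r ler_nat max_card.
  have Un0 : 0 <= #|U|%:R / #|G|%:R :> R by rewrite divr_ge0.
  have dU0 : 0 <= d%:R * #|U|%:R / #|G|%:R :> R by rewrite -mulrA mulr_ge0.
  have dU1 : d%:R * #|U|%:R / #|G|%:R <= d%:R :> R by rewrite -mulrA ler_piMr.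
  have dg : (degree_to w U)%:R <= d%:R :> R by rewrite ler_nat.
  have dg0 : 0 <= (degree_to w U)%:R :> R by [].
  by rewrite ler_norml; apply/andP; split; lra.
have r1 : 0 <= (1 - rho) ^+ size ws <= 1.
  by rewrite exprn_ge0 ?subr_ge0 // exprn_ile1 ?subr_ge0 // lerBlDr lerDl.
have := IH U'; set A := #|_|%:R / _ => IHU.
have -> : A - (1 - rho) ^+ (size ws).+1 * (#|U|%:R / #|G|%:R) =
  (A - (1 - rho) ^+ size ws * (#|U'|%:R / #|G|%:R)) +
  (1 - rho) ^+ size ws * (#|U'|%:R / #|G|%:R - (1 - rho) * (#|U|%:R / #|G|%:R)).
  by rewrite exprSr; ring.
apply: le_trans (ler_normD _ _) _.
have e2 : `|(1 - rho) ^+ size ws * (#|U'|%:R / #|G|%:R - (1 - rho) * (#|U|%:R / #|G|%:R))|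
   <= (Num.max 0 delta + (w \in bad_vertices U)%:R) * rho.
  case/andP: r1 => r10 r11.
  by rewrite normrM (ger0_norm r10) (le_trans _ e1) // ler_piMl.
apply: le_trans (lerD IHU e2) _; rewrite natrD -natr1.
rewrite le_eqVlt; apply/orP; left; apply/eqP; ring.
Qed.

End NeighbourhoodGrowth.

Lemma expr_sub_le (R : realType) (a b : R) s : 0 <= a <= 1 -> 0 <= b <= 1 ->
  `|a ^+ s - b ^+ s| <= s%:R * `|a - b|.
Proof.
move=> /andP[a0 a1] /andP[b0 b1]; elim: s => [|s IH].
  by rewrite !expr0 subrr normr0 mul0r.
have -> : a ^+ s.+1 - b ^+ s.+1 = a * (a ^+ s - b ^+ s) + (a - b) * b ^+ s.
  by rewrite !exprS; ring.
apply: le_trans (ler_normD _ _) _; rewrite -natr1 [leRHS]mulrDl mul1r !normrM.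
rewrite (ger0_norm a0) (ger0_norm (exprn_ge0 s b0)); apply: lerD.
  by rewrite (le_trans _ IH) // ler_piMl.
by rewrite ler_piMr // exprn_ile1.
Qed.

(** Both bases lie in [[0, 1]], so their powers differ by at most [s] times [|1 - r - exp(-r)|]. *)
Lemma expR_pow_approx (R : realType) (r : R) s : 0 <= r <= 1 ->
  `|(1 - r) ^+ s - expR (- (s%:R * r))| <= s%:R * r ^+ 2.
Proof.
move=> /andP[r0 r1]; have -> : expR (- (s%:R * r)) = expR (- r) ^+ s.
  by rewrite -expRM_natl mulrN.
apply: le_trans (expr_sub_le _ _ _) _; first by apply/andP; split; lra.
  by rewrite expR_ge0 expR_le1 oppr_le0.
rewrite ler_wpM2l // ler_norml.
have := expRN_le_quadratic r0; have := expR_ge1Dx (- r); have := sqr_ge0 r.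
by move=> *; apply/andP; split; lra.
Qed.

Lemma exp_partial_sum_le (R : realType) (z : R) m : 0 <= z ->
  \sum_(s < m) z ^+ s / s`!%:R <= expR z.
Proof.
move=> z0; rewrite -(big_mkord xpredT (fun s => z ^+ s / s`!%:R)).
rewrite /expR; apply: (nondecreasing_cvgn_le (u_ := series (exp_coeff z))); last first.
  exact: is_cvg_series_exp_coeff.
apply/nondecreasing_seqP => k; rewrite /series /= big_nat_recr //= lerDl.
exact: exp_coeff_ge0.
Qed.

(** * Poorly expanding sets are unlikely *)

Section ExpansionProbability.
Variables (R : realType) (n d : nat) (lambda : R) (G : sgraph) (eps alpha L : R).
Let N : R := n%:R / d%:R.
Hypotheses (ndl : ndl_graph n d lambda G) (n1 : (1 < n)%N) (d1 : (1 < d)%N)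
  (lam_d : lambda < d%:R) (eps01 : 0 < eps <= 1 / 100)
  (alpha01 : 0 < alpha < eps ^+ 2) (N_large : N^-1 <= eps * alpha / 100)
  (L0 : 0 <= L) (gap : (lambda / (alpha / 10 * d%:R)) ^+ 2 <= expR (- L)).

Definition poorly_expanding (D : {set G}) : bool :=
  (#|D|%:R <= 3 * eps * N) &&
  ~~ (`|#|nbhd D|%:R / #|G|%:R - (1 - expR (- (#|D|%:R / N)))| <= 2 * eps * alpha).

Let Gn : #|G| = n. Proof. by case: ndl. Qed.
Let reg : regular_graph G d. Proof. by case: ndl. Qed.
Let dn : (d <= #|G|)%N.
Proof.
have /card_gt0P[v _] : (0 < #|G|)%N by rewrite Gn ltnW.
by rewrite -(reg v) max_card.
Qed.
Let G0 : (0 < #|G|)%N. Proof. by rewrite Gn ltnW. Qed.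
Let dR0 : 0 < d%:R :> R. Proof. by rewrite ltr0n ltnW. Qed.
Let nR0 : 0 < n%:R :> R. Proof. by rewrite ltr0n ltnW. Qed.
Let N0 : 0 < N. Proof. by rewrite divr_gt0. Qed.
Let e0 : 0 < eps. Proof. by case/andP: eps01. Qed.
Let a0 : 0 < alpha. Proof. by case/andP: alpha01. Qed.

(** Chebyshev's inequality for [degree_variance]. *)
Lemma card_bad_vertices (U : {set G}) :
  #|bad_vertices d (alpha / 10) U|%:R <= expR (- L) * #|G|%:R.
Proof.
have ad : 0 < alpha / 10 * d%:R by rewrite mulr_gt0 // divr_gt0.
have var := degree_variance U ndl n1 lam_d.
have : #|bad_vertices d (alpha / 10) U|%:R * (alpha / 10 * d%:R) ^+ 2 <=
    lambda ^+ 2 * #|G|%:R.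
  apply: (@le_trans _ _ (lambda ^+ 2 * #|U|%:R)); last first.
    by rewrite ler_wpM2l ?sqr_ge0 // ler_nat max_card.
  apply: le_trans var; rewrite -sumr_const big_distrl /= big_mkcond /=.
  apply: ler_sum => w _; rewrite inE; case: ifP => [h|_]; last exact: sqr_ge0.
  rewrite mul1r -[leRHS]real_normK ?num_real // lerXn2r ?nnegrE ?(ltW ad) //.
  by rewrite /degree_to Gn in h; exact: ltW.
rewrite -ler_pdivlMr ?exprn_gt0 // => /le_trans; apply.
rewrite mulrAC ler_wpM2r // -expr_div_n //.
Qed.

(** Of the deviation [2 eps alpha], typical steps explain at most [3 / 10 * eps * alpha] and the
    passage to the exponential a negligible amount, so bad steps must supply
    [3 / 2 * eps * alpha]. *)
Lemma poorly_expanding_bad_steps (ws : seq G) : uniq ws ->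
  poorly_expanding [set w in ws] ->
  3 / 2 * (eps * alpha * N) <= (bad_steps d (alpha / 10) [set: G] ws)%:R.
Proof.
move=> uws; rewrite /poorly_expanding cardsE (card_uniqP uws).
set s := size ws; set b := bad_steps _ _ _ _; set D := [set w in ws].
move=> /andP[s3]; apply: contraR; rewrite -ltNge => bl.
have := untouched_bad_steps (alpha / 10) reg G0 dn [set: G] ws.
rewrite -/s -/b -/D; set rho := d%:R / #|G|%:R.
have rhoE : rho = N^-1 by rewrite /rho /N Gn invf_div.
have a10 : 0 <= alpha / 10 by rewrite divr_ge0 // ltW.
rewrite (max_r a10) cardsT divff ?pnatr_eq0 -?lt0n // mulr1.
have -> : #|[set: G] :\: nbhd D|%:R / #|G|%:R = 1 - #|nbhd D|%:R / #|G|%:R :> R.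
  rewrite setTD -(cardsC (nbhd D)) natrD -{1}[#|~: _|%:R](addKr #|nbhd D|%:R).
  rewrite mulrDl addrC -natrD cardsC divff; first by rewrite mulNr.
  by rewrite pnatr_eq0 -lt0n.
rewrite rhoE => h1.
have r01 : 0 <= N^-1 <= 1.
  by rewrite invr_ge0 ltW //= -rhoE /rho ler_pdivrMr ?ltr0n // mul1r ler_nat.
have h2 := expR_pow_approx s r01.
have sN : s%:R / N <= 3 * eps by rewrite ler_pdivrMr.
have bN : b%:R / N < 3 / 2 * (eps * alpha).
  by rewrite ltr_pdivrMr // -[ltRHS]mulrA.
have sN2 : s%:R * N^-1 ^+ 2 <= 3 * eps * (eps * alpha / 100).
  rewrite expr2 mulrA; have NV0 : 0 <= N^-1 by rewrite invr_ge0 ltW.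
  by apply: ler_pM => //; apply: mulr_ge0.
have sd : s%:R * (alpha / 10) / N <= 3 * eps * (alpha / 10).
  by rewrite [leLHS]mulrAC; apply: ler_wpM2r.
move: h1 h2; rewrite mulrDl !ler_norml.
move: (#|nbhd D|%:R / _) ((1 - N^-1) ^+ s) (expR _) => X Y Z.
move: sd bN sN2.
have ee : eps * (eps * alpha / 100) <= 1 / 100 * (eps * alpha / 100).
  by rewrite ler_pM2r ?divr_gt0 ?mulr_gt0 //; case/andP: eps01.
have := mulr_gt0 e0 a0.
move=> ea0 HA HB HC /andP[h1 h2] /andP[h3 h4].
by apply/andP; split; lra.
Qed.

Lemma poorly_expanding_prob :
  subset_prob ((1 + eps) / d%:R)
    (fun S : {set G} => [exists D : {set G}, (D \subset S) && poorly_expanding D])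
  <= expR (- (3 / 2 * (eps * alpha * N) * L)) *
     (eps^-1 ^+ Num.truncn (3 * eps * N) * expR (4 * eps * N)).
Proof.
have /andP[e0' e1] := eps01.
have p0 : 0 <= (1 + eps) / d%:R by rewrite divr_ge0 //; lra.
have p1 : (1 + eps) / d%:R <= 1.
  have : 2%:R <= d%:R :> R by rewrite ler_nat.
  by rewrite ler_pdivrMr //; lra.
apply: le_trans (subset_prob_exists _ _) _; first by rewrite p0.
set p := (1 + eps) / d%:R; set m := Num.truncn _; set B := poorly_expanding.
set T := 3 / 2 * (eps * alpha * N) * L.
have Bm D : B D -> (#|D| < m.+1)%N.
  move=> /andP[h _]; rewrite ltnS /m truncn_ge_nat //.
  by rewrite !mulr_ge0 // ltW.
(* The union bound is sorted by size; [Bm] guarantees that [inord] does not truncate the size. *)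
rewrite (partition_big (fun D : {set G} => inord #|D| : 'I_m.+1) xpredT) //=.
have count s : (\sum_(D : {set G} | #|D| == s) (B D)%:R) <=
    expR (- T) * ((2 * n%:R) ^+ s / s`!%:R).
  (* Markov's inequality with [tau = expR L]: a poorly expanding ordering weighs at least [expR T],
     while [tau * eta = 1]. *)
  have tau1 : 1 <= expR L by rewrite -expR0 ler_expR.
  have te : expR L * expR (- L) <= 1 by rewrite -expRD subrr expR0.
  have := seq_sum_bad_steps card_bad_vertices s [set: G] tau1 te.
  have := @seq_sum_sets R G s (fun D => expR T * (B D)%:R)
    (fun t => expR L ^+ bad_steps d (alpha / 10) [set: G] t).
  move=> /(_ _ _)/le_trans H /H {H}; rewrite Gn -mulr_sumr mulrA => H.
  rewrite mulrA ler_pdivlMr ?ltr0n ?fact_gt0 // mulrC expRN ler_pdivlMl ?expR_gt0 //.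
  rewrite mulrA [expR T * _]mulrC; apply: H => [t|t ut st].
    by rewrite exprn_ge0 ?expR_ge0.
  case Bt : (B _); last by rewrite mulr0 exprn_ge0 ?expR_ge0.
  rewrite mulr1 -expRM_natr ler_expR /T mulrC ler_wpM2l //.
  exact: poorly_expanding_bad_steps.
have inner (s : 'I_m.+1) :
    \sum_(D | B D && (inord #|D| == s)) p ^+ #|D| <=
    expR (- T) * (eps^-1 ^+ m * ((4 * eps * N) ^+ s / s`!%:R)).
  apply: (@le_trans _ _ (p ^+ s * \sum_(D : {set G} | #|D| == s) (B D)%:R)).
    rewrite mulr_sumr big_mkcond [leRHS]big_mkcond /=; apply: ler_sum => D _.
    case: ifP => [/andP[BD /eqP sD]|_].
      by rewrite -sD inordK ?Bm // eqxx BD mulr1.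
    by case: ifP => _ //; rewrite mulr_ge0 ?exprn_ge0.
  apply: le_trans (ler_wpM2l (exprn_ge0 _ p0) (count s)) _.
  rewrite mulrCA ler_wpM2l ?expR_ge0 // [leLHS]mulrA [leRHS]mulrA ler_wpM2r ?invr_ge0 //.
  rewrite -exprMn.
  (* Since [s <= m], trading [eps^-1 ^+ s] for [eps^-1 ^+ m] leaves an exponential series in
     [4 eps N], much smaller than one in [N]. *)
  have -> : p * (2 * n%:R) = eps^-1 * (2 * eps * (1 + eps) * N).
    by rewrite /p /N; field; rewrite !gt_eqF.
  have eV : 1 <= eps^-1 by rewrite invf_ge1 //; lra.
  rewrite exprMn; apply: ler_pM.
  - by rewrite exprn_ge0 // invr_ge0 ltW.
  - by rewrite exprn_ge0 // !mulr_ge0 ?(ltW e0) ?(ltW N0) //; lra.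
  - by apply: ler_weXn2l => //; rewrite -ltnS.
  - have le4 : 2 * eps * (1 + eps) * N <= 4 * eps * N by rewrite ler_pM2r //; nra.
    have ge0 : 0 <= 2 * eps * (1 + eps) * N.
      by rewrite !mulr_ge0 ?(ltW e0) ?(ltW N0) //; lra.
    have ge0' : 0 <= 4 * eps * N by apply: le_trans le4.
    by apply: lerXn2r; rewrite ?nnegrE.
apply: le_trans (ler_sum _ (fun s _ => inner s)) _.
rewrite -mulr_sumr ler_wpM2l ?expR_ge0 // -mulr_sumr ler_wpM2l //.
  by rewrite exprn_ge0 // invr_ge0 ltW.
by apply: exp_partial_sum_le; rewrite !mulr_ge0 ?(ltW e0) ?(ltW N0).
Qed.

End ExpansionProbability.

(** * The giant component *)

Lemma confinement_prob (R : realType) (G : sgraph) (p h : R) :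
  subset_prob p (fun S : {set G} => confined p h 0 (answers #|G| S set0)) =
  confine_prob p h #|G| 0.
Proof.
have := @answers_law G R p #|G| set0 set0 (fun b => (confined p h 0 b)%:R) (sub0set _).
rewrite setC0 cardsT /confine_prob => /(_ erefl) <-; rewrite /subset_prob big_mkcond.
apply: eq_big => [S|S _]; first by rewrite setI0 eqxx.
rewrite /subset_weight; case: ifP => _; rewrite ?mulr1 ?mulr0 //.
by apply: eq_bigl => v; rewrite inE.
Qed.

Lemma confined_explore (R : realType) (G : sgraph) (S : {set G}) (p h : R) k :
  confined p h 0 (answers #|G| S set0) -> (k <= #|G|)%N ->
  `|#|S :&: explore S set0 k|%:R - p * k%:R| <= h.
Proof.
move=> cf kn; have [|_] := @explore_answers G k S set0; first by rewrite setC0 cardsT.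
rewrite setC0 cardsT setI0 cards0 add0n => ->.
have := confined_prefix cf; rewrite size_answers ?setC0 ?cardsT // => /(_ k kn).
by rewrite add0r.
Qed.

Lemma subset_prob_diff (R : realType) (G : sgraph) (p : R) (A B C : pred {set G}) :
  0 <= p <= 1 -> (forall S, A S -> ~~ B S -> C S) ->
  subset_prob p A - subset_prob p B <= subset_prob p C.
Proof.
move=> p01 ABC; rewrite lerBlDr /subset_prob.
rewrite big_mkcond [X in X + _]big_mkcond [X in _ + X]big_mkcond -big_split /=.
apply: ler_sum => S _; have w0 := subset_weight_ge0 S p01.
case: ifP => AS; last by case: ifP => _; case: ifP => _; rewrite ?addr0 ?add0r ?addr_ge0.
case: (boolP (B S)) => BS; first by case: ifP => _; rewrite ?lerDr ?add0r.
by rewrite ABC // addr0.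
Qed.

(** The factor [c ^+ 2 / 32] is the rate of the maximal inequality; [expR (- (4 / c ^+ 2))] is the
    small ball lower bound. Their product serves both regimes. *)
Definition confinement_rate (R : realType) (c : R) : R :=
  expR (- (4 / c ^+ 2)) * c ^+ 2 / 32.

(* For large [alpha ^+ 2 * N] this is the maximal inequality; for bounded values
   only the small ball estimate keeps the probability away from [0]. *)
Lemma confine_prob_rate (R : realType) (p c alpha N : R) n :
  0 <= p <= 7 / 20 -> 0 < c <= 1 -> 0 < alpha <= 1 -> 0 < N -> p * n%:R <= 2 * N ->
  4 <= alpha ^+ 2 * N -> 40 <= c * alpha * N ->
  1 - expR (- (confinement_rate c * (alpha ^+ 2 * N))) <= confine_prob p (c * alpha * N) n 0.
Proof.
move=> p01 /andP[c0 c1] /andP[a0 a1] N0 pn t4 h40.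
set t := alpha ^+ 2 * N; set h := c * alpha * N in h40 *.
have c2 : 0 < c ^+ 2 by rewrite exprn_gt0.
have h2 : h ^+ 2 = c ^+ 2 * t * N by rewrite /h /t; ring.
have t0 : 0 < t by rewrite /t; lra.
have h20 : 0 < h ^+ 2 by rewrite h2 !mulr_gt0.
set q := expR (- (4 / c ^+ 2)).
have q0 : 0 < q by rewrite expR_gt0.
have q1 : q <= 1 by rewrite -expR0 ler_expR oppr_le0 divr_ge0 ?sqr_ge0.
(* For bounded [t] the rate times [t] is at most [q], so [1 - exp(-q) <= q] suffices. For large [t]
   the factor 2 of the tail bound is at most [expR (c ^+ 2 * t / 32)]. *)
have [tK|tK] := leP (32 / c ^+ 2) t; last first.
  have low : q <= confine_prob p h n 0.
    apply: le_trans (confine_prob_ge n p01 h40); rewrite ler_expR lerN2.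
    rewrite h2 ler_pdivrMr ?mulr_gt0 //.
    have -> : 4 / c ^+ 2 * (c ^+ 2 * t * N) = 4 * t * N by field; rewrite gt_eqF.
    have : 4 * N <= t * N by rewrite ler_pM2r.
    lra.
  apply: le_trans low; rewrite lerBlDr -lerBlDl.
  apply: le_trans (expR_ge1Dx (- q)) _; rewrite ler_expR lerN2.
  rewrite /confinement_rate -/q.
  have : c ^+ 2 * t <= 32 by rewrite mulrC -ler_pdivlMr // ltW.
  move=> ct; have : q * (c ^+ 2 * t) <= q * 32 by rewrite ler_pM2l.
  lra.
(* The minimizer of [- th * h + 4 * N * th^2], using [p n <= 2 N]. *)
pose th := h / (8 * N).
have N8 : 0 < 8 * N by rewrite mulr_gt0.
have hN : h <= N by rewrite /h ler_piMl ?(ltW N0) // mulr_ile1 ?(ltW c0) ?(ltW a0).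
have th01 : 0 <= th <= 1 / 2.
  by rewrite /th divr_ge0 ?(ltW N8) //=; [rewrite ler_pdivrMr //; lra | lra].
have p1 : 0 <= p <= 1 by lra.
have := confine_prob_tail h n 0 p1 th01.
rewrite oppr0 add0r mulrN -mulr2n -[_ *+ 2]mulr_natl -mulrA -expRM_natr -expRD.
move=> tail; rewrite lerBlDl -lerBlDr; apply: (le_trans tail).
have ct : 1 <= c ^+ 2 * t / 32.
  by rewrite ler_pdivlMr // mul1r mulrC -ler_pdivrMr.
apply: (@le_trans _ _ (expR (c ^+ 2 * t / 32) * expR (- (c ^+ 2 * t / 16)))).
  apply: ler_pM; rewrite ?expR_ge0 ?ler0n //.
    by apply: le_trans (expR_ge1Dx _); lra.
  rewrite ler_expR.
  have -> : th * h = c ^+ 2 * t / 8 by rewrite /th mulrAC -expr2 h2; field; rewrite gt_eqF.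
  have -> : 2 * p * th ^+ 2 * n%:R = (p * n%:R) * (c ^+ 2 * t / (32 * N)).
    by rewrite /th expr_div_n h2; field; rewrite gt_eqF.
  have : p * n%:R * (c ^+ 2 * t / (32 * N)) <= 2 * N * (c ^+ 2 * t / (32 * N)).
    by rewrite ler_wpM2r // divr_ge0 ?mulr_ge0 ?ltW.
  have -> : 2 * N * (c ^+ 2 * t / (32 * N)) = c ^+ 2 * t / 16 by field; rewrite gt_eqF.
  lra.
rewrite -expRD ler_expR /confinement_rate -/q.
have : q * (c ^+ 2 * t) <= 1 * (c ^+ 2 * t) by rewrite ler_pM2r // mulr_gt0.
lra.
Qed.

(** Halving the rate absorbs the second failure term: after extracting [expR (- u)], the remaining
    factors are at most [1 - b] and [b]. *)
Lemma expR_split (R : realType) (b eps t N : R) : 0 < b <= 1 / 2 -> 0 < eps ->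
  0 < N -> 4 <= t -> b * t <= eps * N -> 2 / (eps * b) <= N ->
  expR (- (b * t)) + expR (- (eps * N)) <= expR (- (b / 2 * t)).
Proof.
move=> /andP[b0 b1] e0 N0 t4 bt Nl.
pose u := b / 2 * t.
have bt4 : b * 4 <= b * t by rewrite ler_pM2l.
have -> : - (b * t) = - u + - u by rewrite /u; field.
have -> : - (eps * N) = - u + - (eps * N - u) by ring.
rewrite -/u !expRD -mulrDr -[leRHS]mulr1 ler_pM2l ?expR_gt0 //.
have u2 : 2 * b <= u by rewrite /u; lra.
have eN : 0 < eps * N by rewrite mulr_gt0.
have i1 : expR (- u) <= 1 - b.
  have : expR (- u) <= (1 + u)^-1.
    by rewrite expRN lef_pV2 ?posrE ?expR_gt0 ?expR_ge1Dx //; lra.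
  move/le_trans; apply; rewrite -[leLHS]div1r ler_pdivrMr; last by lra.
  nra.
have i2 : expR (- (eps * N - u)) <= b.
  apply: (@le_trans _ _ (expR (- (eps * N / 2)))).
    by rewrite ler_expR lerN2 /u; lra.
  have : expR (- (eps * N / 2)) <= (eps * N / 2)^-1.
    rewrite expRN lef_pV2 ?posrE ?expR_gt0 ?divr_gt0 //.
    by apply: le_trans (expR_ge1Dx _); rewrite lerDr.
  move/le_trans; apply; rewrite invf_div ler_pdivrMr //.
  by move: Nl; rewrite ler_pdivrMr ?mulr_gt0 // => Nl; lra.
lra.
Qed.

(** [ln alpha <= - 2 l] turns the power into at most [exp(-4 l / alpha)], and [10 <= l] makes
    [10 / alpha] at most [exp(l / alpha)]; squaring the product gives the exponent 6. *)
Lemma spectral_ratio_small (R : realType) (eps alpha r l : R) :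
  l = - ln eps -> 10 <= l -> 0 < eps -> 0 < alpha < eps ^+ 2 -> 0 <= r ->
  r <= alpha `^ (2 / alpha) ->
  r < 1 /\ (r * (10 / alpha)) ^+ 2 <= expR (- (6 * l / alpha)).
Proof.
move=> lE l10 e0 /andP[a0 ae] r0 rle.
have lna : ln alpha <= - (2 * l).
  have -> : - (2 * l) = ln (eps ^+ 2) by rewrite lnXn // lE -mulr_natl; ring.
  by rewrite ler_ln ?posrE ?exprn_gt0 // ltW.
have aV : 0 < alpha^-1 by rewrite invr_gt0.
have rle2 : r <= expR (- (4 * l / alpha)).
  apply: (le_trans rle); rewrite /powR gt_eqF // ler_expR.
  have := ler_wpM2l (ltW aV) lna; lra.
have lV : 0 < l / alpha by rewrite divr_gt0 //; lra.
split; first by apply: le_lt_trans rle2 _; rewrite expR_lt1; lra.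
have a10 : 10 / alpha <= expR (l / alpha).
  apply: le_trans (expR_ge1Dx _); have : 10 * alpha^-1 <= l * alpha^-1 by rewrite ler_pM2r.
  lra.
have -> : expR (- (6 * l / alpha)) = (expR (- (4 * l / alpha)) * expR (l / alpha)) ^+ 2.
  by rewrite -expRD -expRM_natl; congr expR; ring.
have d0 : 0 <= 10 / alpha by rewrite divr_ge0 // ltW.
have ge0 : 0 <= r * (10 / alpha) by rewrite mulr_ge0.
have le1 : r * (10 / alpha) <= expR (- (4 * l / alpha)) * expR (l / alpha).
  by apply: ler_pM.
by apply: lerXn2r => //; rewrite nnegrE // (le_trans ge0).
Qed.

Lemma confinement_rate_bounds (R : realType) (c : R) :
  0 < c <= 1 -> 0 < confinement_rate c <= 1 / 2.
Proof.
move=> /andP[c0 c1]; have c2 : 0 < c ^+ 2 by rewrite exprn_gt0.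
have c21 : c ^+ 2 <= 1 by rewrite exprn_ile1 // ltW.
have q0 := expR_gt0 (- (4 / c ^+ 2)).
have q1 : expR (- (4 / c ^+ 2)) <= 1.
  by rewrite -expR0 ler_expR oppr_le0 divr_ge0 ?sqr_ge0.
rewrite /confinement_rate; apply/andP; split; first by rewrite divr_gt0 ?mulr_gt0.
have := ler_pM (ltW q0) (ltW c2) q1 c21; lra.
Qed.

(** [(eps alpha N)^2] is the product of [alpha^2 N >= 4] and [eps^2 N >= 200^2]. *)
Lemma exploration_scale (R : realType) (eps alpha N : R) :
  0 < eps -> 0 < alpha -> 0 < N -> 4 <= alpha ^+ 2 * N ->
  (20 * 10 / eps) ^+ 2 <= N -> 20 * 20 <= eps * alpha * N.
Proof.
move=> e0 a0 N0 t4 N1.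
have N4 : (20 * 20) ^+ 2 <= 4 * (eps ^+ 2 * N).
  have := ler_wpM2l (sqr_ge0 eps) N1.
  have -> : eps ^+ 2 * (20 * 10 / eps) ^+ 2 = (20 * 10) ^+ 2 by field; rewrite gt_eqF.
  lra.
have t4' : 4 * (eps ^+ 2 * N) <= (eps * alpha * N) ^+ 2.
  have e2N : 0 <= eps ^+ 2 * N by rewrite mulr_ge0 ?sqr_ge0 // ltW.
  by have := ler_wpM2r e2N t4; congr (_ <= _); ring.
have ge0 : 0 <= eps * alpha * N by rewrite !mulr_ge0 // ltW.
have k0 : 0 <= 20 * 20 :> R by rewrite mulr_ge0.
by have := le_trans N4 t4'; rewrite ler_pXn2r.
Qed.

Lemma largest_component_prob (R : realType) (eps x : R) (n d : nat)
    (alpha lambda : R) (G : sgraph) (N := n%:R / d%:R)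
    (b := confinement_rate (eps / 10)) :
  0 < eps <= 1 / 100 -> 10 <= - ln eps -> survival_root eps x -> (3 <= d)%N ->
  (20 * 10 / eps) ^+ 2 <= N -> 2 / (eps * b) <= N ->
  2 * Num.sqrt (d%:R / n%:R) < alpha -> alpha < eps ^+ 2 ->
  ndl_graph n d lambda G -> lambda / d%:R <= alpha `^ (2 / alpha) ->
  1 - expR (- (b / 2 * (alpha ^+ 2 * N))) <=
  subset_prob ((1 + eps) / d%:R)
    (fun S : {set G} =>
       `|(largest_component_size (induced_subgraph S))%:R - x * N| <= 7 * alpha * N).
Proof.
move=> eps01 l10 rx d3 N1 N2 alo ahi ndl lam.
have [e0 e1] := andP eps01.
have d0 : 0 < d%:R :> R by rewrite ltr0n; case: (d) d3.
have d3R : 3%:R <= d%:R :> R by rewrite ler_nat.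
have N0 : 0 < N by apply: lt_le_trans N1; rewrite exprn_gt0 ?divr_gt0.
have NdE : n%:R = N * d%:R by rewrite /N divfK ?gt_eqF.
have n0 : 0 < n%:R :> R by rewrite NdE mulr_gt0.
have Nn : N <= n%:R by rewrite NdE ler_peMr ?(ltW N0) //; lra.
have a0 : 0 < alpha by apply: le_lt_trans alo; rewrite mulr_ge0 ?sqrtr_ge0.
have alpha01 : 0 < alpha < eps ^+ 2 by rewrite a0.
have e2 : eps ^+ 2 <= 1 by rewrite exprn_ile1 // ?(ltW e0) //; lra.
have t4 : 4 <= alpha ^+ 2 * N.
  have : (2 * Num.sqrt (d%:R / n%:R)) ^+ 2 <= alpha ^+ 2.
    by apply: lerXn2r; rewrite ?nnegrE ?mulr_ge0 ?sqrtr_ge0 ?ltW.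
  rewrite exprMn sqr_sqrtr ?divr_ge0 // => h.
  have := ler_wpM2r (ltW N0) h; rewrite /N.
  have -> : 2 ^+ 2 * (d%:R / n%:R) * (n%:R / d%:R) = 4 :> R by field; rewrite !gt_eqF.
  by [].
have aN' := exploration_scale e0 a0 N0 t4 N1.
have N_large : N^-1 <= eps * alpha / 100.
  by rewrite -[leLHS]div1r ler_pdivrMr //; lra.
have Gn : #|G| = n by case: ndl.
have G_large : #|G|%:R^-1 <= eps * alpha / 100.
  by rewrite Gn (le_trans _ N_large) // lef_pV2.
have h40 : 40 <= eps / 10 * alpha * N by lra.
have a1 : 0 < alpha <= 1 by rewrite a0 /=; lra.
have n1 : (1 < n)%N.
  rewrite -(ltr_nat R); apply: lt_le_trans Nn.
  have : eps * alpha * N <= 1 * N.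
    by rewrite ler_pM2r // mulr_ile1 ?(ltW e0) ?(ltW a0) //; lra.
  lra.
have c01 : 0 < eps / 10 <= 1 by apply/andP; split; lra.
have b01 : 0 < b <= 1 / 2 by apply: confinement_rate_bounds.
have bt : b * (alpha ^+ 2 * N) <= eps * N.
  rewrite mulrA ler_pM2r //.
  have a2 : alpha ^+ 2 <= alpha by rewrite expr2 ler_piMr ?(ltW a0) //; lra.
  have e3 : eps ^+ 2 <= eps by rewrite expr2 ler_piMr ?(ltW e0) //; lra.
  have : b * alpha ^+ 2 <= 1 * alpha ^+ 2 by rewrite ler_wpM2r ?sqr_ge0 //; lra.
  lra.
have sp := expR_split b01 e0 N0 t4 bt N2.
pose p := (1 + eps) / d%:R.
(* [d >= 3] and [eps <= 1 / 100] give [p <= 101 / 300]. *)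
have p01 : 0 <= p <= 7 / 20.
  by rewrite /p divr_ge0 ?(ltW d0) //=; [rewrite ler_pdivrMr //; lra | lra].
have p1 : 0 <= p <= 1 by lra.
have pn : p * n%:R = (1 + eps) * N by rewrite /p /N; field; rewrite gt_eqF.
have pn2 : p * n%:R <= 2 * N by rewrite pn ler_pM2r //; lra.
have conf := confine_prob_rate p01 c01 a1 N0 pn2 t4 h40.
rewrite -Gn -confinement_prob in conf.
clear N1 N2 aN' h40 e2 pn2 bt t4.
have lam0 : 0 <= lambda.
  by case: ndl => _ _ [s [_ _ ->]]; rewrite le_max normr_ge0.
have [lam1 lam2] := spectral_ratio_small erefl l10 e0 alpha01
  (divr_ge0 lam0 (ltW d0)) lam.
have lam_d : lambda < d%:R by move: lam1; rewrite ltr_pdivrMr // mul1r.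
set l := - ln eps in l10 lam2.
have lam3 : (lambda / (alpha / 10 * d%:R)) ^+ 2 <= expR (- (6 * l / alpha)).
  move: lam2; congr (_ ^+ 2 <= _); field; by rewrite !gt_eqF.
have L0 : 0 <= 6 * l / alpha by rewrite divr_ge0 ?(ltW a0) //; lra.
have d1 : (1 < d)%N by apply: ltn_trans d3.
have fail := poorly_expanding_prob ndl n1 d1 lam_d eps01 alpha01 N_large L0 lam3.
(* In units of [eps N] the exponent is at most [-9 l + 3 l + 4], far below [-1] because
   [l >= 10]. *)
have fail2 : subset_prob ((1 + eps) / d%:R)
    (fun S : {set G} => [exists D : {set G}, (D \subset S) && poorly_expanding n d eps alpha D])
    <= expR (- (eps * N)).
  apply: (le_trans fail); rewrite -/N.
  have -> : eps^-1 = expR l by rewrite /l expRN lnK.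
  have -> : 3 / 2 * (eps * alpha * N) * (6 * l / alpha) = 9 * (eps * N) * l.
    by field; rewrite gt_eqF.
  rewrite -expRM_natr -!expRD ler_expR.
  have eN : 0 <= 3 * eps * N by rewrite !mulr_ge0 ?(ltW e0) ?(ltW N0).
  have /andP[m1 _] := truncn_itv eN.
  have l0 : 0 <= l by lra.
  have := ler_wpM2l l0 m1.
  have : 0 <= (eps * N) * (l - 10) by rewrite mulr_ge0 ?mulr_ge0 ?(ltW e0) ?(ltW N0) //; lra.
  have : 0 < eps * N by rewrite mulr_gt0.
  lra.
have good : forall S : {set G},
   confined p (eps / 10 * alpha * N) 0 (answers #|G| S set0) ->
   ~~ [exists D : {set G}, (D \subset S) && poorly_expanding n d eps alpha D] ->
   `|(largest_component_size (induced_subgraph S))%:R - x * N| <= 7 * alpha * N.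
  move=> S cf; rewrite negb_exists => /forallP ex.
  apply: (largest_component_near eps01) => //.
  - by rewrite Gn ltnW.
  - move=> k kn; have := confined_explore cf kn; congr (`|_ - _| <= _).
    by rewrite Gn /p /N; field; rewrite !gt_eqF.
  - move=> D DS D3; have := ex D; rewrite DS /= /poorly_expanding D3 /= negbK.
    by [].
apply: le_trans (subset_prob_diff p1 good).
apply: le_trans (lerB conf fail2); rewrite -/b.
move: sp; move: (expR _) (expR (- (eps * N))) (expR _) => E1 E2 E3 sp; lra.
Qed.

Local Open Scope classical_set_scope.
Local Open Scope ring_scope.

Theorem theorem2 (R : realType) :
  exists eps0 : R, 0 < eps0 /\
  forall eps : R, 0 < eps -> eps < eps0 ->
  exists x : R,
    unique (fun y : R => 0 < y < 1 /\ y = (1 + eps) * (1 - expR (- y))) x /\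
  exists beta : R, 0 < beta /\
  forall d : nat -> nat,
    (forall n, (3 <= d n)%N) ->
    (fun n => (d n)%:R : R^o) =o_\oo (fun n => n%:R : R^o) ->
  \forall n \near \oo, forall (alpha lambda : R) (G : sgraph),
    2 * Num.sqrt ((d n)%:R / n%:R) < alpha -> alpha < eps ^+ 2 ->
    ndl_graph n (d n) lambda G ->
    lambda / (d n)%:R <= alpha `^ (2 / alpha) ->
    1 - expR (- (beta * (alpha ^+ 2 * n%:R / (d n)%:R))) <=
    subset_prob ((1 + eps) / (d n)%:R)
      (fun S : {set G} =>
         `|(largest_component_size (induced_subgraph S))%:R - x * n%:R / (d n)%:R|
           <= 7 * alpha * n%:R / (d n)%:R).
Proof.
(* The bound 1/100 serves the numerical estimates, and [expR (- 10)] ensures [- ln eps >= 10]. *)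
exists (Num.min (1 / 100) (expR (- 10))); split.
  by rewrite lt_min expR_gt0 andbT; lra.
move=> eps e0; rewrite lt_min => /andP[e1 e10].
have eps01 : 0 < eps <= 1 / 100 by rewrite e0 ltW.
have l10 : 10 <= - ln eps.
  by rewrite lerNr -[- 10]expRK ler_ln ?posrE ?expR_gt0 // ltW.
have [x rx] := survival_root_exists eps01.
exists x; split; first by split=> // y ry; apply: survival_root_uniq e0 rx ry.
set b := confinement_rate (eps / 10).
have b0 : 0 < b.
  by rewrite /b /confinement_rate divr_gt0 ?mulr_gt0 ?expR_gt0 ?exprn_gt0 // divr_gt0.
exists (b / 2); split; first by rewrite divr_gt0.
move=> d d3 dlo.
(* The sum dominates both lower bounds required of [n / d]; [d = o(n)] makes [n / d] eventually
   exceed it. *)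
pose N0 : R := (20 * 10 / eps) ^+ 2 + 2 / (eps * b).
have N1 : 0 < (20 * 10 / eps) ^+ 2 by rewrite exprn_gt0 ?divr_gt0.
have N2 : 0 < 2 / (eps * b) by apply: divr_gt0 => //; exact: mulr_gt0.
have N00 : 0 < N0 by rewrite addr_gt0.
have NV : 0 < N0^-1 by rewrite invr_gt0.
move/eqoP: dlo => /(_ _ NV) dlo.
near=> n => alpha lambda G alo ahi ndl lam.
have nN : N0 <= n%:R / (d n)%:R.
  have : `|(d n)%:R| <= N0^-1 * `|n%:R| :> R by near: n.
  rewrite !normr_nat mulrC ler_pdivlMr // => h.
  by rewrite ler_pdivlMr ?ltr0n 1?mulrC //; case: (d n) (d3 n).
have M1 : (20 * 10 / eps) ^+ 2 <= n%:R / (d n)%:R by apply: le_trans nN; rewrite lerDl ltW.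
have M2 : 2 / (eps * b) <= n%:R / (d n)%:R by apply: le_trans nN; rewrite lerDr ltW.
have := largest_component_prob eps01 l10 rx (d3 n) M1 M2 alo ahi ndl lam.
by rewrite !mulrA.
Unshelve. all: by end_near.
Qed.
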